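(* Let $w\in S_n$ be a vexillary permutation and let $\{(p_i,q_i):i=1,\dots,d\}$ be an arbitrary flagging set of $w$. Write $\lambda(w)=(\lambda_1,\dots,\lambda_d)$. Then the double Grothendieck polynomial $G_w(x|b)$ satisfies $$G_w(x|b)=\det\left(\sum_{s=0}^\infty\binom{i-d}{s}\beta^s\,G^{[p_i,q_i]}_{\lambda_i+j-i+s}(x|b)\right)_{1\le i,j\le d}$$ and also $$G_w(x|b)=\det\left(\sum_{s=0}^\infty\binom{i-j}{s}\beta^s\,G^{[p_i,q_i]}_{\lambda_i+j-i+s}(x|b)\right)_{1\le i,j\le d}.$$
   Context: $x=(x_1,x_2,\dots)$ and $b=(b_1,b_2,\dots)$ are indeterminates, $\beta$ is a formal parameter, and identities are in formal power series in $x,b$ over $\mathbb{Z}[\beta]$. $\binom{a}{s}$ is the generalized binomial coefficient for $a\in\mathbb{Z}$. **The series $G^{[p,q]}_m$.** For nonnegative integers $p,q$ and $m\in\mathbb{Z}$, $G_m^{[p,q]}(x|b)$ is defined by $$\sum_{m\in\mathbb{Z}}G_m^{[p,q]}(x|b)u^m=\frac{1}{1+\beta u^{-1}}\prod_{1\le i\le p}\frac{1+\beta x_i}{1-x_iu}\prod_{1\le j\le q}\bigl(1+b_j(\beta+u)\bigr),$$ where $\frac1{1+\beta u^{-1}}$ is expanded in powers of $u^{-1}$ and $\frac1{1-x_iu}$ in powers of $u$. **Double Grothendieck polynomials.** $G_w(x|b)$ is the ($\beta$-version of the) Lascoux–Schützenberger double Grothendieck polynomial, normalized as follows. Write $u\oplus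 v=u+v+\beta uv$. For the longest element $w_0\in S_n$, $G_{w_0}(x|b)=\prod_{i+j\le n}(x_i\oplus b_j)$, and for $\ell(ws_i)=\ell(w)-1$ (with $s_i=(i\ i{+}1)$), $G_{ws_i}=\pi_i G_w$, where $$\pi_i f=\frac{(1+\beta x_{i+1})f-(1+\beta x_i)\,s_i f}{x_i-x_{i+1}}$$ and $s_i$ acts by exchanging $x_i$ and $x_{i+1}$. **Vexillary permutations.** For $w\in S_n$, $r_w(p,q)=\#\{i\le p: w(i)\le q\}$. $w$ is vexillary if there are no $a<b<c<d$ with $w(b)<w(a)<w(d)<w(c)$. The diagram is $D(w)=\{(p,q)\in\{1,\dots,n\}^2: w(p)>q,\ w^{-1}(q)>p\}$, and the essential set is $\mathcal{E}ss(w)=\{(p,q): p,q\le n-1,\ w(p)>q,\ w(p+1)\le q,\ w^{-1}(q)>p,\ w^{-1}(q+1)\le p\}$. The partition $\lambda(w)$ of a vexillary $w$ is the one whose Young diagram $\{(i,j):1\le j\le\lambda_i\}$ has, for every $k\in\mathbb{Z}$, as many boxes on the $k$-th diagonal $\{(i,i+k)\}$ as $D(w)$; set $\lambda_i=0$ for $i$ larger than its length. **Flagging set.** A flagging set of a vexillary $w$ is a subset $\{(p_i,q_i):i=1,\dots,d\}$ of $\{1,\dots,n\}^2$ such that (i) $p_1\le\cdots\le p_d$ and $q_1\ge\cdots\ge q_d$; (ii) it contains $\mathcal{E}ss(w)$; (iii) $p_i-r_w(p_i,q_i)=i$ for $i=1,\dots,d$. *)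

(* Defs.v *)
From HB Require Import structures.
From mathcomp Require Import all_boot all_order all_algebra all_fingroup.
From mathcomp Require Import boolp classical_sets functions cardinality fsbigop.
From mathcomp Require Import mpoly.
From mathcomp Require Import ring zify.

Set Implicit Arguments.
Unset Strict Implicit.
Unset Printing Implicit Defensive.

Import Order.TTheory GRing.Theory Num.Theory.
Local Open Scope ring_scope.

(** * Formal power series in [n] variables *)

Record mfps (n : nat) (R : comNzRingType) :=
  MFPS { mfps_coef :> 'X_{1..n} -> R }.

HB.instance Definition _ n R := gen_eqMixin (mfps n R).
HB.instance Definition _ n R := gen_choiceMixin (mfps n R).

Section MfpsRing.
Variables (n : nat) (R : comNzRingType).
Implicit Types f g h : mfps n R.

Lemma mfpsP f g : (forall m, f m = g m) -> f = g.
Proof. by case: f g => [f] [g] /= fg; congr MFPS; apply/funext. Qed.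

Definition mfps_of_mpoly (p : {mpoly R[n]}) : mfps n R := MFPS (fun m => p@_m).

Definition mfps_zero : mfps n R := MFPS (fun _ => 0).
Definition mfps_opp f : mfps n R := MFPS (fun m => - f m).
Definition mfps_add f g : mfps n R := MFPS (fun m => f m + g m).
Definition mfps_mul f g : mfps n R :=
  MFPS (fun m => \sum_(k : 'X_{1..n < (mdeg m).+1, (mdeg m).+1}
                        | m == (k.1 + k.2)%MM) f k.1 * g k.2).

Fact mfps_addA : associative mfps_add.
Proof. by move=> f g h; apply: mfpsP => m /=; rewrite addrA. Qed.
Fact mfps_addC : commutative mfps_add.
Proof. by move=> f g; apply: mfpsP => m /=; rewrite addrC. Qed.
Fact mfps_add0 : left_id mfps_zero mfps_add.
Proof. by move=> f; apply: mfpsP => m /=; rewrite add0r. Qed.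
Fact mfps_addN : left_inverse mfps_zero mfps_opp mfps_add.
Proof. by move=> f; apply: mfpsP => m /=; rewrite addNr. Qed.

HB.instance Definition _ :=
  GRing.isZmodule.Build (mfps n R) mfps_addA mfps_addC mfps_add0 mfps_addN.

Definition mfps_trunc (d : nat) f : {mpoly R[n]} :=
  \sum_(m : 'X_{1..n < d}) f m *: 'X_[m].

Lemma mcoeff_trunc d f m : (mdeg m < d)%N -> (mfps_trunc d f)@_m = f m.
Proof.
move=> lt_md; rewrite /mfps_trunc raddf_sum /=.
rewrite (bigD1 (BMultinom lt_md)) //= mcoeffZ mcoeffX eqxx mulr1.
rewrite big1 ?addr0 // => k ne_k; rewrite mcoeffZ mcoeffX.
suff /negPf-> : bmnm k != m by rewrite mulr0.
by apply: contra ne_k => /eqP e; apply/eqP/val_inj.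
Qed.

Lemma mfps_mulE d f g m :
  (mdeg m < d)%N -> mfps_mul f g m = (mfps_trunc d f * mfps_trunc d g)@_m.
Proof.
move=> lt_md; rewrite mcoeffM /=; apply: eq_bigr => -[k1 k2] /= _.
have lt_k (k : 'X_{1..n < (mdeg m).+1}) : (mdeg k < d)%N.
  by apply: leq_trans (bmdeg k) _.
by rewrite !mcoeff_trunc ?lt_k.
Qed.

Lemma mcoeffM_eq (p p' q q' : {mpoly R[n]}) m :
  (forall k, (mdeg k <= mdeg m)%N -> p@_k = p'@_k) ->
  (forall k, (mdeg k <= mdeg m)%N -> q@_k = q'@_k) ->
  (p * q)@_m = (p' * q')@_m.
Proof.
move=> epp eqq; rewrite !mcoeffM; apply: eq_bigr => -[k1 k2] /= _.
by rewrite epp ?eqq // -ltnS bmdeg.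
Qed.

Fact mfps_mulA : associative mfps_mul.
Proof.
move=> f g h; apply: mfpsP => m; set d := (mdeg m).+1.
rewrite !(@mfps_mulE d) //.
transitivity ((mfps_trunc d f * (mfps_trunc d g * mfps_trunc d h))@_m).
  apply: mcoeffM_eq => // k le_k; rewrite mcoeff_trunc ?ltnS //.
  by rewrite (@mfps_mulE d) ?ltnS.
rewrite mulrA; apply: mcoeffM_eq => // k le_k; rewrite mcoeff_trunc ?ltnS //.
by rewrite (@mfps_mulE d) ?ltnS.
Qed.

Fact mfps_mulC : commutative mfps_mul.
Proof.
move=> f g; apply: mfpsP => m.
by rewrite !(@mfps_mulE (mdeg m).+1) // mulrC.
Qed.

Definition mfps_one : mfps n R := mfps_of_mpoly 1.

Fact mfps_mul1 : left_id mfps_one mfps_mul.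
Proof.
move=> f; apply: mfpsP => m; rewrite (@mfps_mulE (mdeg m).+1) //.
rewrite -[RHS](@mcoeff_trunc (mdeg m).+1) // -[in RHS](mul1r (mfps_trunc _ f)).
by apply: mcoeffM_eq => // k le_k; rewrite mcoeff_trunc ?ltnS.
Qed.

Fact mfps_mulDl : left_distributive mfps_mul +%R.
Proof.
move=> f g h; apply: mfpsP => m /=; rewrite -big_split /=.
by apply: eq_bigr => k _; rewrite mulrDl.
Qed.

Fact mfps_one_neq0 : mfps_one != 0.
Proof.
apply/eqP => /(congr1 (fun f : mfps n R => f 0%MM)) /= /eqP.
by rewrite mcoeff1 eqxx oner_eq0.
Qed.

HB.instance Definition _ :=
  GRing.Zmodule_isComNzRing.Build (mfps n R)
    mfps_mulA mfps_mulC mfps_mul1 mfps_mulDl mfps_one_neq0.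

Lemma mfps_of_mpolyD : {morph mfps_of_mpoly : p q / p + q}.
Proof. by move=> p q; apply: mfpsP => m /=; rewrite mcoeffD. Qed.

Lemma mfps_of_mpolyM : {morph mfps_of_mpoly : p q / p * q}.
Proof.
move=> p q; apply: mfpsP => m; rewrite /= mcoeffM.
by apply: eq_bigr.
Qed.

(** Coefficientwise sum of a family. [\sum_(_ \in _)] is [0] by convention on
    an infinite support, so this is meaningful only when each monomial occurs
    in finitely many members, as in all the uses below: there the order of the
    [k]-th member tends to infinity with [k]. *)
Definition mfps_sum (I : choiceType) (F : I -> mfps n R) : mfps n R :=
  MFPS (fun m => \sum_(k \in [set: I]%classic) F k m).

End MfpsRing.

(** * Base ring and variables *)

Notation Zbeta := {poly int}.

(** [x_1, ..., x_n, b_1, ..., b_n], all indexed from [0]; a permutation in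
    ['S_n] and bounds [p, q <= n] involve no other variable. *)
Notation dpoly n := {mpoly Zbeta[(n + n)%N]}.
Notation dseries n := (mfps (n + n) Zbeta).

Section Variables.
Variable n : nat.
Definition beta : dpoly n := ('X : Zbeta)%:MP.
Definition xvar (i : 'I_n) : dpoly n := 'X_(lshift n i).
Definition bvar (j : 'I_n) : dpoly n := 'X_(rshift n j).
End Variables.
Arguments beta {n}.

(** * The series [G_m^{[p,q]}(x|b)] *)

Section Gseries.
Variable n : nat.
Local Notation A := (dseries n).
Local Notation toA := (@mfps_of_mpoly (n + n) Zbeta).
(* power series in [u] over [A] *)
Local Notation Au := (mfps 1 A).
Local Notation toAu := (@mfps_of_mpoly 1 A).

Definition geom (c : A) : Au := MFPS (fun m => c ^+ mdeg m).

Lemma geomP (c : A) : geom c * toAu (1 - c *: 'X_ord0) = 1.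
Proof.
apply: mfpsP => m; rewrite (@mfps_mulE _ _ (mdeg m).+1) //.
rewrite (@mcoeffM_eq _ _ _ (mfps_trunc (mdeg m).+1 (geom c))
           _ (1 - c *: 'X_ord0)) // => [|k le_k]; last by rewrite mcoeff_trunc.
rewrite mulrBr mulr1 -scalerAr mcoeffB mcoeffZ mcoeff_trunc //=.
have [->|nz] := eqVneq m 0%MM.
  by rewrite rmorphM /= mcoeffX mnm1_eq0 mulr0 mulr0 subr0 mdeg0 expr0 mcoeff1 eqxx.
have -> : m = (U_(ord0) + (m - U_(ord0)))%MM.
  apply/mnmP => i; rewrite !mnmDE mnmBE mnm1E (ord1 i) eqxx subnKC // lt0n.
  apply: contra nz => /eqP m0; apply/eqP/mnmP => j.
  by rewrite (ord1 j) mnm0E.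
rewrite mcoeffMX mcoeff_trunc; last by rewrite ltnS mdegD leq_addl.
by rewrite /= mdegD mdeg1 exprS subrr mcoeff1 mnmD_eq0 mnm1_eq0.
Qed.

Definition Gprod (p q : nat) : Au :=
  \prod_(i < n | (i < p)%N)
     (toAu (toA (1 + beta * xvar i))%:MP * geom (toA (xvar i))) *
  \prod_(j < n | (j < q)%N)
     toAu (1 + (toA (bvar j))%:MP * ((toA beta)%:MP + 'X_ord0)).

(** Doubly infinite series in [u], as their coefficient functions. *)
Definition laurent := int -> A.

Definition laurent_of (P : Au) : laurent :=
  fun m => if m is Posz k then P [multinom k | _ < 1] else 0.

(* [1 / (1 + beta u^-1)] expanded in powers of [u^-1] *)
Definition inv_1_beta_uV : laurent :=
  fun m => if m <= 0 then (- toA beta) ^+ `|m|%N else 0.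

Definition laurent_mul (f g : laurent) : laurent :=
  fun m => mfps_sum (fun k : int => f k * g (m - k)).

Definition Gseries (p q : nat) : laurent :=
  laurent_mul inv_1_beta_uV (laurent_of (Gprod p q)).

End Gseries.

(** Generalized binomial coefficient; the division is exact. *)
Definition gbinom (a : int) (s : nat) : int :=
  ((\prod_(t < s) (a - t%:Z)) %/ (s`!)%:Z)%Z.

(** * Permutations *)

(* positions and values are numbered from [0] *)
Section Permutations.
Variable n : nat.
Implicit Types w : 'S_n.

Definition inversions w : {set 'I_n * 'I_n} :=
  [set ab : 'I_n * 'I_n | (ab.1 < ab.2)%N && (w ab.2 < w ab.1)%N].

Definition perm_length w : nat := #|inversions w|.

Definition longest : 'S_n := perm (@rev_ord_inj n).

(* [w s_i], i.e. [w] after [s_i]: products in ['S_n] compose left to right. *)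
Definition mul_s w (i i' : 'I_n) : 'S_n := (tperm i i' * w)%g.

Definition rank_fun w (p q : nat) : nat :=
  #|[set i : 'I_n | (i < p)%N && (w i < q)%N]|.

Definition vexillary w : Prop :=
  ~ exists a b c d : 'I_n,
      [/\ (a < b < c)%N, (c < d)%N, (w b < w a)%N, (w a < w d)%N
        & (w d < w c)%N].

Definition diagram w : {set 'I_n * 'I_n} :=
  [set ij : 'I_n * 'I_n | (ij.2 < w ij.1)%N && (ij.1 < (w^-1)%g ij.2)%N].

(* the boxes [(p, q)] are numbered from [1] *)
Definition essential w (p q : nat) : Prop :=
  exists i i' j j' : 'I_n,
    [/\ p = i.+1, q = j.+1, i' = i.+1 :> nat, j' = j.+1 :> nat
      & [/\ (j < w i)%N, (w i' <= j)%N,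
            (i < (w^-1)%g j)%N & ((w^-1)%g j' <= i)%N]].

Definition is_partition (lam : seq nat) : Prop :=
  sorted geq lam /\ 0%N \notin lam.

Definition young (lam : seq nat) : seq (nat * nat) :=
  [seq (i, j) | i <- iota 0 (size lam), j <- iota 0 (nth 0%N lam i)].

(** [lam] is the partition [lambda(w)]. *)
Definition shape_of w (lam : seq nat) : Prop :=
  is_partition lam /\
  forall k : int,
    count (fun ij => ij.2%:Z - ij.1%:Z == k) (young lam)
    = #|[set ij in diagram w | (ij.2%:Z - ij.1%:Z == k)]|.

(* [p i] and [q i], for [i : 'I_d], stand for [p_{i+1}] and [q_{i+1}]. *)
Definition flagging_set w (d : nat) (p q : 'I_d -> nat) : Prop :=
  [/\ forall i, (1 <= p i <= n)%N /\ (1 <= q i <= n)%N,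
      forall i j : 'I_d, (i <= j)%N -> (p i <= p j)%N /\ (q j <= q i)%N,
      forall a c, essential w a c -> exists i, p i = a /\ q i = c
    & forall i, (p i - rank_fun w (p i) (q i))%N = i.+1].

End Permutations.

(** * Double Grothendieck polynomials *)

Lemma lincomb2 (R : comNzRingType) (be a a' c c' f tf sf stf g sg h : R) :
  (c - c') * g = (1 + be * c') * f - (1 + be * c) * tf ->
  (c - c') * sg = (1 + be * c') * sf - (1 + be * c) * stf ->
  (a - a') * h = (1 + be * a') * g - (1 + be * a) * sg ->
  (a - a') * (c - c') * h =
    (1 + be * a') * (1 + be * c') * f - (1 + be * a') * (1 + be * c) * tf
    - (1 + be * a) * (1 + be * c') * sf + (1 + be * a) * (1 + be * c) * stf.
Proof.
move=> eg esg eh; rewrite -mulrA mulrCA eh mulrBr mulrCA eg mulrCA esg; ring.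
Qed.

Lemma lincomb2_inj (R : idomainType) (be a a' c c' f tf sf stf g h : R) :
  a - a' != 0 -> c - c' != 0 ->
  (a - a') * (c - c') * g =
    (1 + be * a') * (1 + be * c') * f - (1 + be * a') * (1 + be * c) * tf
    - (1 + be * a) * (1 + be * c') * sf + (1 + be * a) * (1 + be * c) * stf ->
  (c - c') * (a - a') * h =
    (1 + be * c') * (1 + be * a') * f - (1 + be * c') * (1 + be * a) * sf
    - (1 + be * c) * (1 + be * a') * tf + (1 + be * c) * (1 + be * a) * stf ->
  g = h.
Proof.
move=> aa cc eg eh; apply: (@mulfI _ ((a - a') * (c - c'))).
  by rewrite mulf_neq0.
rewrite eg [in RHS](mulrC (a - a')) eh; ring.
Qed.

Lemma lincomb3l (R : comNzRingType)
    (a b c A B C f sf tf stf tsf q g1 tg1 sg1 stg1 g2 sg2 g3 : R) :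
  (a - b) * g1 = B * f - A * sf -> (a - c) * tg1 = C * tf - A * tsf ->
  (b - a) * sg1 = A * sf - B * f -> (b - c) * stg1 = C * stf - B * q ->
  (b - c) * g2 = C * g1 - B * tg1 -> (a - c) * sg2 = C * sg1 - A * stg1 ->
  (a - b) * g3 = B * g2 - A * sg2 ->
  (a - b) * (a - b) * (a - c) * (b - c) * g3 =
    (a - c) * B * C * (B * f - A * sf) - (a - b) * B * B * (C * tf - A * tsf)
    + (b - c) * A * C * (A * sf - B * f) + (a - b) * A * A * (C * stf - B * q).
Proof.
move=> <- <- <- <- e2 e2' e3.
have -> : (a - b) * (a - b) * (a - c) * (b - c) * g3
        = (a - b) * (a - c) * (b - c) * ((a - b) * g3) by ring.
rewrite e3.
have -> : (a - b) * (a - c) * (b - c) * (B * g2 - A * sg2)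
  = (a - b) * (a - c) * B * ((b - c) * g2)
    - (a - b) * (b - c) * A * ((a - c) * sg2) by ring.
rewrite e2 e2'; ring.
Qed.

Lemma lincomb3r (R : comNzRingType)
    (a b c A B C f sf tf stf tsf q h1 sh1 th1 tsh1 h2 th2 h3 : R) :
  (b - c) * h1 = C * f - B * tf -> (a - c) * sh1 = C * sf - A * stf ->
  (c - b) * th1 = B * tf - C * f -> (a - b) * tsh1 = B * tsf - A * q ->
  (a - b) * h2 = B * h1 - A * sh1 -> (a - c) * th2 = C * th1 - A * tsh1 ->
  (b - c) * h3 = C * h2 - B * th2 ->
  (b - c) * (a - b) * (a - c) * (b - c) * h3 =
    (a - c) * B * C * (C * f - B * tf) - (b - c) * A * C * (C * sf - A * stf)
    + (a - b) * B * C * (B * tf - C * f) + (b - c) * A * B * (B * tsf - A * q).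
Proof.
move=> <- <- <- <- e2 e2' e3.
have -> : (b - c) * (a - b) * (a - c) * (b - c) * h3
        = (a - b) * (a - c) * (b - c) * ((b - c) * h3) by ring.
rewrite e3.
have -> : (a - b) * (a - c) * (b - c) * (C * h2 - B * th2)
  = (b - c) * (a - c) * C * ((a - b) * h2)
    - (a - b) * (b - c) * B * ((a - c) * th2) by ring.
rewrite e2 e2'; ring.
Qed.

Lemma lincomb3 (R : idomainType) (be a b c f sf tf stf tsf q g h : R) :
  let A := 1 + be * a in let B := 1 + be * b in let C := 1 + be * c in
  a - b != 0 -> a - c != 0 -> b - c != 0 ->
  (a - b) * (a - b) * (a - c) * (b - c) * g =
    (a - c) * B * C * (B * f - A * sf) - (a - b) * B * B * (C * tf - A * tsf)
    + (b - c) * A * C * (A * sf - B * f) + (a - b) * A * A * (C * stf - B * q) ->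
  (b - c) * (a - b) * (a - c) * (b - c) * h =
    (a - c) * B * C * (C * f - B * tf) - (b - c) * A * C * (C * sf - A * stf)
    + (a - b) * B * C * (B * tf - C * f) + (b - c) * A * B * (B * tsf - A * q) ->
  g = h.
Proof.
move=> A B C ab ac bc eg eh.
apply: (@mulfI _ ((a - b) * (a - b) * (a - c) * (b - c) * (b - c))).
  by rewrite !mulf_neq0.
rewrite [LHS]mulrAC eg [in RHS](_ : _ * h
  = (a - b) * ((b - c) * (a - b) * (a - c) * (b - c) * h)); last by ring.
rewrite eh /A /B /C; ring.
Qed.

Section Grothendieck.
Variable n : nat.
Implicit Types (w : 'S_n) (f g : dpoly n) (i j : 'I_n).
Local Notation x := (@xvar n).
Local Notation b := (@bvar n).

Definition s_act i i' : dpoly n -> dpoly n :=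
  msym (tperm (lshift n i) (lshift n i')).

HB.instance Definition _ i i' := GRing.RMorphism.on (s_act i i').

Lemma s_act_beta i i' : s_act i i' beta = beta.
Proof. by rewrite /s_act /msym mmapC. Qed.

Lemma s_act_x i i' k : s_act i i' (x k) = x (tperm i i' k).
Proof.
rewrite /s_act /msym mmapX mmap1U /xvar; congr 'X_(_).
by rewrite (inj_tperm _ _ _ (@lshift_inj _ _)).
Qed.

Lemma s_actK i i' : involutive (s_act i i').
Proof. by move=> f; rewrite /s_act -msymMm tperm2 msym1m. Qed.

Lemma x_sub_neq0 i i' : i != i' -> x i - x i' != 0.
Proof.
rewrite subr_eq0; apply: contra => /eqP /(congr1 (mcoeff U_(lshift n i)%MM)).
rewrite /xvar !mcoeffX eqxx eq_mnm1 (inj_eq (@lshift_inj _ _)) => /eqP.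
by case: (eqVneq i' i) => // _; rewrite oner_eq0.
Qed.

Definition sdvd i i' f := exists g, (x i - x i') * g = f - s_act i i' f.

Lemma sdvdM i i' f g : sdvd i i' f -> sdvd i i' g -> sdvd i i' (f * g).
Proof.
move=> [f' ef] [g' eg]; exists (f' * g + s_act i i' f * g').
by rewrite mulrDr mulrA ef mulrCA eg rmorphM /=; ring.
Qed.

Lemma sdvd1 i i' : sdvd i i' 1.
Proof. by exists 0; rewrite mulr0 rmorph1 subrr. Qed.

Lemma sdvdU i i' (k : 'I_(n + n)) : sdvd i i' 'X_k.
Proof.
rewrite /sdvd /s_act /msym mmapX mmap1U.
case: tpermP => [->|->|_ _]; [exists 1|exists (-1)|exists 0].
- by rewrite mulr1.
- by rewrite mulrN1 opprB.
- by rewrite mulr0 subrr.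
Qed.

Lemma sdvd_all i i' f : sdvd i i' f.
Proof.
elim/mpolyind: f => [|c m f _ _ [g eg]].
  by exists 0; rewrite mulr0 rmorph0 subr0.
suff [h eh] : sdvd i i' 'X_[m].
  exists (c *: h + g); rewrite mulrDr eg -scalerAr eh rmorphD /= /s_act msymZ.
  by rewrite scalerBr opprD addrACA.
rewrite mpolyXE_id; apply: big_ind => [|p q|k _].
- exact: sdvd1.
- exact: sdvdM.
- elim: (m k) => [|e IH]; first by rewrite expr0; apply: sdvd1.
  by rewrite exprS; apply: sdvdM => //; apply: sdvdU.
Qed.

Lemma pi_exists i i' f :
  exists g, (x i - x i') * g
    = (1 + beta * x i') * f - (1 + beta * x i) * s_act i i' f.
Proof.
have [g eg] := sdvd_all i i' f.
exists ((1 + beta * x i') * g - beta * s_act i i' f).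
rewrite mulrBr mulrCA eg; ring.
Qed.

(** [pi_i f], by exact division; used with [i' = i + 1]. *)
Definition pi_op i i' f : dpoly n := sval (cid (pi_exists i i' f)).

Lemma pi_opP i i' f :
  (x i - x i') * pi_op i i' f
    = (1 + beta * x i') * f - (1 + beta * x i) * s_act i i' f.
Proof. exact: svalP (cid (pi_exists i i' f)). Qed.


Lemma s_act_pi j j' i i' f :
  (x (tperm j j' i) - x (tperm j j' i')) * s_act j j' (pi_op i i' f)
    = (1 + beta * x (tperm j j' i')) * s_act j j' f
      - (1 + beta * x (tperm j j' i)) * s_act j j' (s_act i i' f).
Proof.
have /(congr1 (s_act j j')) := pi_opP i i' f.
by rewrite rmorphM !rmorphB !rmorphM !rmorphD !rmorphM rmorph1 /= !s_act_x
           s_act_beta.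
Qed.

Lemma s_act_comm i i' j j' f :
  i != j -> i != j' -> i' != j -> i' != j' ->
  s_act i i' (s_act j j' f) = s_act j j' (s_act i i' f).
Proof.
move=> ij ij' i'j i'j'; rewrite /s_act -!msymMm; congr msym.
rewrite conjgC tpermJ !tpermD // (inj_eq (@lshift_inj _ _)) //.
Qed.

Lemma s_act_braid i j k f : i != j -> j != k -> i != k ->
  s_act i j (s_act j k (s_act i j f)) = s_act j k (s_act i j (s_act j k f)).
Proof.
move=> ij jk ik; rewrite /s_act -!msymMm; congr msym.
set I := lshift n i; set J := lshift n j; set K := lshift n k.
have [IJ JK IK] : [/\ I != J, J != K & I != K].
  by rewrite !(inj_eq (@lshift_inj _ _)).
have -> : (tperm I J * (tperm J K * tperm I J) = tperm J K ^ tperm I J)%g.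
  by rewrite conjgE tpermV.
have -> : (tperm J K * (tperm I J * tperm J K) = tperm I J ^ tperm J K)%g.
  by rewrite conjgE tpermV.
by rewrite !tpermJ tpermR tpermL (tpermD IK JK) tpermD // eq_sym.
Qed.

Lemma pi_comm i i' j j' f :
  i != i' -> j != j' -> i != j -> i != j' -> i' != j -> i' != j' ->
  pi_op i i' (pi_op j j' f) = pi_op j j' (pi_op i i' f).
Proof.
move=> ii jj ij ij' i'j i'j'.
have [ji j'i ji' j'i'] : [/\ j != i, j' != i, j != i' & j' != i'].
  by split; rewrite eq_sym.
have [t1 t2] : tperm i i' j = j /\ tperm i i' j' = j' by rewrite !tpermD.
have [t3 t4] : tperm j j' i = i /\ tperm j j' i' = i' by rewrite !tpermD.
have sC := s_act_comm f ij ij' i'j i'j'.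
have [nz nz'] := (x_sub_neq0 ii, x_sub_neq0 jj).
have e1 := s_act_pi i i' j j' f; rewrite t1 t2 in e1.
have e2 := s_act_pi j j' i i' f; rewrite t3 t4 in e2.
have k1 := lincomb2 (pi_opP j j' f) e1 (pi_opP i i' _).
have k2 := lincomb2 (pi_opP i i' f) e2 (pi_opP j j' _).
rewrite -sC in k2.
exact: lincomb2_inj nz nz' k1 k2.
Qed.

Lemma pi_braid i j k f : i != j -> j != k -> i != k ->
  pi_op i j (pi_op j k (pi_op i j f)) = pi_op j k (pi_op i j (pi_op j k f)).
Proof.
move=> ij jk ik.
have [ji kj ki] : [/\ j != i, k != j & k != i] by split; rewrite eq_sym.
have two i1 i2 j1 j2 k1 k2 g :
  (x (tperm j1 j2 (tperm i1 i2 k1)) - x (tperm j1 j2 (tperm i1 i2 k2)))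
    * s_act j1 j2 (s_act i1 i2 (pi_op k1 k2 g))
  = (1 + beta * x (tperm j1 j2 (tperm i1 i2 k2)))
      * s_act j1 j2 (s_act i1 i2 g)
    - (1 + beta * x (tperm j1 j2 (tperm i1 i2 k1)))
      * s_act j1 j2 (s_act i1 i2 (s_act k1 k2 g)).
  have /(congr1 (s_act j1 j2)) := s_act_pi i1 i2 k1 k2 g.
  by rewrite rmorphM !rmorphB !rmorphM !rmorphD !rmorphM rmorph1 /= !s_act_x
             s_act_beta.
have [sK tK] := (s_actK i j f, s_actK j k f).
have sij : tperm i j k = k by rewrite tpermD.
have sjk : tperm j k i = i by rewrite tpermD.
have [nz1 nz2 nz3] := And3 (x_sub_neq0 ij) (x_sub_neq0 ik) (x_sub_neq0 jk).
have sB := s_act_braid f ij jk ik.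
have g1 := pi_opP i j f.
have tg1 := s_act_pi j k i j f.
have sg1 := s_act_pi i j i j f.
have stg1 := two j k i j i j f.
have sg2 := s_act_pi i j j k (pi_op i j f).
have h1 := pi_opP j k f.
have sh1 := s_act_pi i j j k f.
have th1 := s_act_pi j k j k f.
have tsh1 := two i j j k j k f.
have th2 := s_act_pi j k i j (pi_op j k f).
rewrite sjk tpermL in tg1.
rewrite tpermL tpermR sK in sg1.
rewrite sjk !tpermL sij in stg1.
rewrite tpermR sij in sg2.
rewrite tpermR sij in sh1.
rewrite tpermL tpermR tK in th1.
rewrite tpermR sij sjk tpermR in tsh1.
rewrite sjk tpermL in th2.
rewrite -sB in tsh1.
have eg := lincomb3l g1 tg1 sg1 stg1 (pi_opP j k _) sg2 (pi_opP i j _).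
have eh := lincomb3r h1 sh1 th1 tsh1 (pi_opP i j _) th2 (pi_opP j k _).
exact: lincomb3 nz1 nz2 nz3 eg eh.
Qed.

Lemma tperm_adj_lt i i' (a c : 'I_n) : i' = i.+1 :> nat -> (a < c)%N ->
  (a != i) || (c != i') -> (tperm i i' a < tperm i i' c)%N.
Proof.
move=> ii' ac; rewrite -!val_eqE /= => ne.
have toN (u v : 'I_n) : u <> v -> (u : nat) <> v by move=> uv /val_inj.
case: (tpermP i i' a) ne ac => [->|->|/toN ai /toN ai'];
  case: (tpermP i i' c) => [->|->|/toN ci /toN ci'] ne ac; lia.
Qed.

Lemma mul_sE w i i' a : mul_s w i i' a = w (tperm i i' a).
Proof. by rewrite permM. Qed.

Lemma mul_sK w i i' : mul_s (mul_s w i i') i i' = w.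
Proof. by rewrite /mul_s mulgA tperm2 mul1g. Qed.

Lemma length_ascent w i i' : i' = i.+1 :> nat -> (w i < w i')%N ->
  perm_length (mul_s w i i') = (perm_length w).+1.
Proof.
move=> ii' wi; pose s := tperm i i'.
pose F (ac : 'I_n * 'I_n) := (s ac.1, s ac.2).
have F_inj : injective F.
  by move=> [a c] [a' c'] [/perm_inj-> /perm_inj->].
have E : inversions (mul_s w i i') = (i, i') |: F @: inversions w.
  apply/setP => -[a c]; rewrite in_setU1 inE /= !mul_sE -/s.
  have [/eqP[-> ->]|ne] := boolP ((a, c) == (i, i')).
    by rewrite /s tpermL tpermR ii' ltnSn wi.
  have -> : (a, c) = F (s a, s c) by rewrite /F /= !tpermK.
  rewrite /= (mem_imset _ _ F_inj) inE /=; apply: andb_id2r => wsc.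
  apply/idP/idP => [ac|sac].
    by apply: tperm_adj_lt => //; move: ne; rewrite xpair_eqE negb_and.
  rewrite -[a](tpermK i i') -[c](tpermK i i'); apply: tperm_adj_lt => //.
  rewrite -negb_and -xpair_eqE; apply: contraTN wsc => /eqP[-> ->].
  by rewrite -leqNgt ltnW.
suff ni : (i, i') \notin F @: inversions w.
  by rewrite /perm_length E cardsU1 ni (card_imset _ F_inj).
apply/imsetP => -[[a c]]; rewrite inE /= => /andP[ac _] [ea ec].
move: ac; rewrite -(tpermK i i' a) -(tpermK i i' c) -/s -ea -ec /s tpermL tpermR.
by rewrite ii' ltnNge leqnSn.
Qed.

Lemma length_step w i i' : i' = i.+1 :> nat ->
  (perm_length (mul_s w i i')).+1 = perm_length w -> (w i' < w i)%N.
Proof.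
move=> ii' e; rewrite ltnNge leq_eqVlt; apply/negP => /orP[/eqP/val_inj/perm_inj|].
  by move/(congr1 val) => /=; rewrite ii'; lia.
by move=> /(length_ascent ii'); lia.
Qed.

Lemma perm_length_le w : (perm_length w <= n * n)%N.
Proof. by rewrite -[X in (_ <= X * X)%N]card_ord -card_prod; apply: max_card. Qed.

(** [G_w] for all [w] in [S_n], as a family of polynomials. *)
Definition is_double_grothendieck (G : 'S_n -> dpoly n) : Prop :=
  G (longest n)
    = \prod_(i < n) \prod_(j < n | (i.+1 + j.+1 <= n)%N)
        (x i + b j + beta * x i * b j)
  /\ forall w i i', i' = i.+1 :> nat ->
       (perm_length (mul_s w i i')).+1 = perm_length w ->
       G (mul_s w i i') = pi_op i i' (G w).

Definition ascent w (ii' : 'I_n * 'I_n) : bool :=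
  (ii'.2 == ii'.1.+1 :> nat) && (w ii'.1 < w ii'.2)%N.

Fixpoint groth_rec (top : dpoly n) (k : nat) w : dpoly n :=
  if k is k'.+1 then
    if [pick ii' | ascent w ii'] is Some ii' then
      pi_op ii'.1 ii'.2 (groth_rec top k' (mul_s w ii'.1 ii'.2))
    else top
  else top.

Lemma mul_s_comm w i i' j j' :
  i != j -> i != j' -> i' != j -> i' != j' ->
  mul_s (mul_s w j j') i i' = mul_s (mul_s w i i') j j'.
Proof.
move=> ij ij' i'j i'j'; rewrite /mul_s !mulgA; congr (_ * _)%g.
by rewrite conjgC tpermJ !tpermD // eq_sym.
Qed.

Lemma mul_s_braid w i j k : i != j -> j != k -> i != k ->
  mul_s (mul_s (mul_s w i j) j k) i j = mul_s (mul_s (mul_s w j k) i j) j k.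
Proof.
move=> ij jk ik; rewrite /mul_s !mulgA; congr (_ * _)%g.
have -> : (tperm i j * tperm j k * tperm i j = tperm j k ^ tperm i j)%g.
  by rewrite conjgE tpermV mulgA.
have -> : (tperm j k * tperm i j * tperm j k = tperm i j ^ tperm j k)%g.
  by rewrite conjgE tpermV mulgA.
by rewrite !tpermJ tpermR tpermL (tpermD ik jk) tpermD // eq_sym.
Qed.

Lemma groth_rec_step top k w i i' :
  i' = i.+1 :> nat -> (w i < w i')%N -> (k + perm_length w = n * n)%N ->
  groth_rec top k w = pi_op i i' (groth_rec top k.-1 (mul_s w i i')).
Proof.
elim/ltn_ind: k w i i' => -[|k] IH w i i' ii' wi ek.
  have := perm_length_le (mul_s w i i'); rewrite length_ascent //; lia.
rewrite /=; case: pickP => [[j j'] /andP[/= /eqP jj' wj]|/(_ (i, i'))]; last first.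
  by rewrite /ascent /= ii' eqxx wi.
move: (groth_rec top) IH => gr IH.
have li := length_ascent ii' wi; have lj := length_ascent jj' wj.
have eki : (k + perm_length (mul_s w i i') = n * n)%N by lia.
have ekj : (k + perm_length (mul_s w j j') = n * n)%N by lia.
have [eij|nij] := eqVneq i j.
  have <- : i' = j' by apply: val_inj; rewrite /= ii' jj' eij.
  by rewrite eij.
have braid (a c e : 'I_n) : c = a.+1 :> nat -> e = c.+1 :> nat ->
    (w a < w c)%N -> (w c < w e)%N ->
    (k + perm_length (mul_s w a c) = n * n)%N ->
    (k + perm_length (mul_s w c e) = n * n)%N ->
  pi_op a c (gr k (mul_s w a c))
  = pi_op c e (gr k (mul_s w c e)).
  move=> ca ec wac wce kac kce.
  have [nac nce nae] : [/\ a != c, c != e & a != e].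
    by split; rewrite -val_eqE /= ?ec ca; lia.
  have [nca nec nea] : [/\ c != a, e != c & e != a] by split; rewrite eq_sym.
  have wae := ltn_trans wac wce.
  have a1 : (mul_s w a c c < mul_s w a c e)%N by rewrite !mul_sE tpermR tpermD.
  have l1 := length_ascent ec a1.
  have a2 : (mul_s (mul_s w a c) c e a < mul_s (mul_s w a c) c e c)%N.
    by rewrite !mul_sE tpermL (tpermD nca nea) tpermL tpermD.
  have l2 := length_ascent ca a2.
  have b1 : (mul_s w c e a < mul_s w c e c)%N by rewrite !mul_sE tpermL tpermD.
  have m1 := length_ascent ca b1.
  have b2 : (mul_s (mul_s w c e) a c c < mul_s (mul_s w c e) a c e)%N.
    by rewrite !mul_sE tpermR (tpermD nae nce) tpermR tpermD.
  have m2 := length_ascent ec b2.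
  have b := perm_length_le (mul_s (mul_s (mul_s w a c) c e) a c).
  case: k IH kac kce {ek eki ekj} => [|[|k]] IH kac kce; try by lia.
  have q1 := IH k.+2 (ltnSn _) _ c e ec a1 kac.
  have q2 := IH k.+1 (ltnW (ltnSn _)) _ a c ca a2 ltac:(lia).
  have r1 := IH k.+2 (ltnSn _) _ a c ca b1 kce.
  have r2 := IH k.+1 (ltnW (ltnSn _)) _ c e ec b2 ltac:(lia).
  rewrite /= in q1 q2 r1 r2.
  rewrite q1 q2 r1 r2 (mul_s_braid w nac nce nae).
  exact: (pi_braid _ nac nce nae).
have [eji|nji] := eqVneq i' j.
  by subst j; rewrite (braid i i' j').
have [eij'|nij'] := eqVneq j' i.
  by subst i; rewrite (braid j j' i').
have ni'j' : i' != j' by rewrite -val_eqE /= ii' jj' eqSS.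
have nii' : i != i' by rewrite -val_eqE /= ii'; lia.
have njj' : j != j' by rewrite -val_eqE /= jj'; lia.
have ij' : i != j' by rewrite eq_sym.
have [ji j'i ji' j'i'] : [/\ j != i, j' != i, j != i' & j' != i'].
  by split; rewrite eq_sym.
have ai : (mul_s w j j' i < mul_s w j j' i')%N by rewrite !mul_sE !tpermD.
have aj : (mul_s w i i' j < mul_s w i i' j')%N by rewrite !mul_sE !tpermD.
have q1 := IH k (ltnSn _) _ i i' ii' ai ekj.
have q2 := IH k (ltnSn _) _ j j' jj' aj eki.
have sC := mul_s_comm w nij ij' nji ni'j'.
rewrite q1 q2 sC; exact: (pi_comm _ njj' nii' ji ji' j'i j'i').
Qed.

Lemma double_grothendieck_exists : exists G, is_double_grothendieck G.
Proof.
pose top : dpoly n := \prod_(i < n) \prod_(j < n | (i.+1 + j.+1 <= n)%N)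
        (x i + b j + beta * x i * b j).
exists (fun w => groth_rec top (n * n - perm_length w) w); split.
  case: (n * n - _)%N => [|k] //=.
  case: pickP => // -[i i'] /andP[/= /eqP ii'].
  rewrite !permE /= ii' => lt; have := ltn_ord i'; move: lt; lia.
move=> w i i' ii' e; have wi := length_step ii' e.
have ai : (mul_s w i i' i < mul_s w i i' i')%N by rewrite !mul_sE tpermL tpermR.
have := perm_length_le w => le.
rewrite (groth_rec_step _ ii' ai); last by lia.
by rewrite mul_sK; congr (pi_op _ _ (groth_rec _ _ _)); lia.
Qed.

Definition double_grothendieck : 'S_n -> dpoly n :=
  sval (cid double_grothendieck_exists).

Lemma double_grothendieckP : is_double_grothendieck double_grothendieck.
Proof. exact: svalP (cid double_grothendieck_exists). Qed.

End Grothendieck.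

(* Main.v *)
Require Import Defs.
From HB Require Import structures.
From mathcomp Require Import all_boot all_order all_algebra all_fingroup.
From mathcomp Require Import boolp classical_sets fsbigop.
From mathcomp Require Import mpoly.
From mathcomp Require Import ring zify.

Set Implicit Arguments.
Unset Strict Implicit.
Unset Printing Implicit Defensive.

Import Order.TTheory GRing.Theory Num.Theory.
Local Open Scope ring_scope.

(** Let [T = 1 + beta u^-1] and let [P^{[p,q]}(u)] be the double product in the
    definition of [G^{[p,q]}(u)], so that [G^{[p,q]} = T^-1 P^{[p,q]}]. Once it is
    known that [lambda_i = q_i - p_i + i], row [i] of the first matrix consists of
    the coefficients of [u^(q_i - p_i + j)] in [T^(i-d) G^{[p_i,q_i]}], and only the
    pairs [(p_i, q_i)] matter. The proof follows [G_w] down from dominant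
    permutations by divided differences.

    - One divided difference. Apart from factors symmetric in [x_a, x_(a+1)], the
      series with [p = a] is [(1 + beta x_a) / (1 - x_a u)], and [pi_a] turns it into
      [u] times the series with [p = a + 1] ([Gpow_pi]). If exactly one [p_k] equals
      [a], then [pi_a] acts on that row alone and changes [p_k] into [a + 1]
      ([flag_det_pi]).

    - The permutations. Given a flagging set of [w], let [k] be the first index
      with [p_k <> k], and put [a = p_k - 1]. Then [w(a) <= q_k < w(a+1)], so that
      [G_w = pi_a G_{w s_a}], and replacing [p_k] by [a] yields a flagging set of
      [w s_a] ([flag_step]). This lowers the sum of the [p_i] and ends with [p_i = i]
      for all [i].

    - The dominant case. If all [p_i = i], then the diagram of [w] is
      [{(i, j) : j <= q_i}]. Both sides equal the product of [x_i (+) b_j] over it: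
      [G_w] by divided differences from the longest element ([groth_dominant]), the
      determinant because column operations that remove the variables
      [x_1, x_2, ...] one by one make the matrix triangular ([flag_det_dominant]).

    - The partition. Along a diagonal [p - r_w(p,q)] changes by at most one at each
      step and increases exactly at the boxes of [D(w)]. Avoiding 2143 means that
      no decrease precedes a box, so the number of boxes on a diagonal is the
      maximum of [p - r_w(p,q)] or [q - r_w(p,q)] over it. As every box of [D(w)] leads
      to an essential box of the same rank, the flagging set knows these maxima
      ([flag_upper], [shape_flag]).

    The second matrix arises from the first by adding [beta] times the next
    column repeatedly ([det_pascal]). *)

(** * Infinite sums of power series *)

Section SeriesTools.
Variables (n : nat) (R : comNzRingType).
Local Notation A := (mfps n R).
Implicit Types (f g : A) (m : 'X_{1..n}).

Lemma mfpsD f g m : (f + g) m = f m + g m. Proof. by []. Qed.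
Lemma mfpsN f m : (- f) m = - f m. Proof. by []. Qed.
Lemma mfps0 m : (0 : A) m = 0. Proof. by []. Qed.

Lemma mfps_sumr (I : Type) (r : seq I) (P : pred I) (F : I -> A) m :
  (\sum_(i <- r | P i) F i) m = \sum_(i <- r | P i) F i m.
Proof. exact: (big_morph (fun f : A => f m)). Qed.

Lemma mfps_mulXE i f m :
  (mfps_of_mpoly 'X_i * f) m = if (0 < m i)%N then f (m - U_(i))%MM else 0.
Proof.
rewrite [LHS](@mfps_mulE _ _ (mdeg m).+1) //; case: ifP => mi.
  have e : m = (U_(i) + (m - U_(i)))%MM.
    by rewrite addmC submK // lep1mP -lt0n.
  rewrite mulrC (@mcoeffM_eq _ _ _ (mfps_trunc (mdeg m).+1 f) _ 'X_i) //;
    last by move=> k lek; rewrite mcoeff_trunc.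
  rewrite [X in _@_X = _]e mcoeffMX mcoeff_trunc // ltnS.
  by rewrite [X in (_ <= mdeg X)%N]e mdegD leq_addl.
rewrite mcoeffM big1 // => -[k1 k2] /= /eqP em.
rewrite mcoeff_trunc; last by exact: bmdeg.
rewrite /= mcoeffX; case: eqP => [e|_]; last by rewrite mul0r.
by move: mi; rewrite (congr1 (fun k : 'X_{1..n} => k i) em) mnmDE -e mnm1E eqxx.
Qed.

Lemma mfps_mulCE c f m : (mfps_of_mpoly c%:MP * f) m = c * f m.
Proof.
rewrite [LHS](@mfps_mulE _ _ (mdeg m).+1) //.
rewrite (@mcoeffM_eq _ _ _ c%:MP _ (mfps_trunc (mdeg m).+1 f)) //;
  last by move=> k lek; rewrite mcoeff_trunc.
by rewrite mcoeffCM mcoeff_trunc.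
Qed.

Fact mfps_of_mpoly_zmod : zmod_morphism (@mfps_of_mpoly n R).
Proof. by move=> p q; apply: mfpsP => m /=; rewrite mcoeffB. Qed.
Fact mfps_of_mpoly_monoid : monoid_morphism (@mfps_of_mpoly n R).
Proof. by split=> //; apply: mfps_of_mpolyM. Qed.
HB.instance Definition _ := GRing.isZmodMorphism.Build {mpoly R[n]} A
  (@mfps_of_mpoly n R) mfps_of_mpoly_zmod.
HB.instance Definition _ := GRing.isMonoidMorphism.Build {mpoly R[n]} A
  (@mfps_of_mpoly n R) mfps_of_mpoly_monoid.

Definition ord_ge (e : nat) f := forall m, (mdeg m < e)%N -> f m = 0.

Lemma ord_geD e f g : ord_ge e f -> ord_ge e g -> ord_ge e (f + g).
Proof. by move=> hf hg m hm; rewrite mfpsD hf ?hg ?addr0. Qed.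

Lemma ord_geM e e' f g : ord_ge e f -> ord_ge e' g -> ord_ge (e + e') (f * g).
Proof.
move=> hf hg m hm; rewrite [LHS]/= big1 // => -[k1 k2] /= /eqP em.
have {}hm : (mdeg k1 + mdeg k2 < e + e')%N by rewrite -mdegD -em.
have [lt|ge] := ltnP (mdeg k1) e; first by rewrite hf ?mul0r.
by rewrite [X in _ * X]hg ?mulr0 // -(ltn_add2l e) (leq_ltn_trans _ hm) ?leq_add2r.
Qed.

Lemma ord_geMl e f g : ord_ge e g -> ord_ge e (f * g).
Proof. by move=> hg; apply: (@ord_geM 0). Qed.

Lemma ord_geX i : ord_ge 1 (mfps_of_mpoly 'X_i).
Proof.
move=> m; rewrite ltnS leqn0 mdeg_eq0 => /eqP->.
by rewrite /= mcoeffX mnm1_eq0.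
Qed.

(** The one way in which infinite sums are handled: each identity is checked at
    one monomial, where it becomes an identity between finite sums. *)
Lemma mfps_sumE (F : nat -> A) N m :
  (forall s, (N <= s)%N -> F s m = 0) ->
  mfps_sum F m = \sum_(s < N) F s m.
Proof.
move=> hF; rewrite [LHS]/= (fsbigE (iota 0 N)) ?iota_uniq //=; last first.
  by move=> s _; rewrite mem_iota add0n leq0n /= -leqNgt => /hF.
rewrite -(big_mkord xpredT (fun s => F s m)) /index_iota subn0.
by apply: eq_bigl => i; rewrite in_setT.
Qed.

Lemma mfps_sum_int (F : int -> A) :
  (forall k : int, 0 < k -> F k = 0) ->
  mfps_sum F = mfps_sum (fun s : nat => F (- s%:Z)).
Proof.
move=> hF; apply: mfpsP => m /=.
have <- : \sum_(k \in [set k : int | k <= 0]%classic) F k m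
          = \sum_(k \in [set: int]%classic) F k m.
  apply: fsbig_widen => // k [_ /negP]; rewrite -ltNge => h.
  exact: (congr1 (fun f : A => f m) (hF k h)).
apply: (reindex_fsbig (fun s : nat => - s%:Z)); split => //=.
- by move=> s _ /=; lia.
- by move=> s t _ _ /oppr_inj [].
by move=> k /= hk; exists `|k|%N => //; lia.
Qed.

Implicit Types (c : nat -> A) (u v : int -> A).

(** Convergence to [0] at [+oo] for the degree topology: what a series in
    negative powers of [u] needs in order to act on the sequence. *)
Definition null u := forall e : nat, exists M : int, forall k, M <= k -> ord_ge e (u k).

Lemma nullZ a u : null u -> null (fun k => a * u k).
Proof. by move=> hu e; have [M hM] := hu e; exists M => k /hM; apply: ord_geMl. Qed.

Lemma null_shift (t : int) u : null u -> null (fun k => u (k + t)).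
Proof.
move=> hu e; have [M hM] := hu e; exists (M - t) => k hk.
by apply: hM; rewrite -lerBlDr.
Qed.

(** [tail_sum c u] is the action on [u] of the power series [sum_s c_s S^s]
    in the backward shift [(S u)_k = u_(k+1)]; the series converges when
    [u] is null. *)
Definition tail_sum c u (k : int) : A :=
  mfps_sum (fun s : nat => c s * u (k + s%:Z)).

Lemma null_mono u k m : null u ->
  exists N : nat, forall (a : A) s, (N <= s)%N -> (a * u (k + s%:Z)) m = 0.
Proof.
move=> /(_ (mdeg m).+1) [M hM]; exists `|M - k|%N => a s hs.
by apply: (@ord_geMl (mdeg m).+1) => //; apply: hM; lia.
Qed.

Lemma tail_sumD c u v k : null u -> null v ->
  tail_sum c (fun k => u k + v k) k = tail_sum c u k + tail_sum c v k.
Proof.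
move=> hu hv; apply: mfpsP => m; rewrite mfpsD.
have [N hN] := null_mono k m hu; have [N' hN'] := null_mono k m hv.
rewrite !(@mfps_sumE _ (maxn N N')) => [|s|s|s].
- by rewrite -big_split; apply: eq_bigr => s _; rewrite mulrDr.
- by rewrite geq_max => /andP[_]; apply: hN'.
- by rewrite geq_max => /andP[h _]; apply: hN.
- by rewrite geq_max mulrDr mfpsD => /andP[h h']; rewrite hN ?hN' ?addr0.
Qed.

Lemma mfps_mul_trunc a f g m :
  (forall k, (mdeg k <= mdeg m)%N -> f k = g k) -> (a * f) m = (a * g) m.
Proof.
move=> h; rewrite [LHS](@mfps_mulE _ _ (mdeg m).+1) // [RHS](@mfps_mulE _ _ (mdeg m).+1) //.
by apply: mcoeffM_eq => // k hk; rewrite !mcoeff_trunc ?ltnS ?h.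
Qed.

Lemma tail_sumZ c a u k : null u ->
  tail_sum c (fun k => a * u k) k = a * tail_sum c u k.
Proof.
move=> hu; apply: mfpsP => m.
have [M hM] := hu (mdeg m).+1; pose N := `|M - k|%N.
have hN b s : (N <= s)%N -> ord_ge (mdeg m).+1 (b * u (k + s%:Z)).
  by move=> hs; apply: ord_geMl; apply: hM; rewrite /N in hs; lia.
rewrite (@mfps_sumE _ N) => [|s hs]; last first.
  by rewrite mulrCA; apply: (@ord_geMl (mdeg m).+1) => //; apply: hN.
rewrite (@mfps_mul_trunc a _ (\sum_(s < N) c s * u (k + s%:Z))) => [|l hl].
  by rewrite mulr_sumr mfps_sumr; apply: eq_bigr => s _; rewrite mulrCA.
rewrite (@mfps_sumE _ N) ?mfps_sumr // => s hs.
by apply: (hN _ _ hs); rewrite ltnS.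
Qed.

Lemma tail_sum_shift c t u k :
  tail_sum c (fun k => u (k + t)) k = tail_sum c u (k + t).
Proof. by congr mfps_sum; apply/funext => s; rewrite addrAC. Qed.

Lemma null_tail_sum c u : null u -> null (tail_sum c u).
Proof.
move=> hu e; have [M hM] := hu e; exists M => k hk m hm.
rewrite (@mfps_sumE _ 0) ?big_ord0 // => s _.
by apply: (@ord_geMl e) => //; apply: hM; lia.
Qed.

(** The series of [c'] is [1 + b S] times that of [c]. Both the inverse of
    [1 + beta S] and Pascal's rule for its powers are instances. *)
Lemma tail_sum_step c c' b u k : null u ->
  c' 0%N = c 0%N -> (forall s, c' s.+1 = c s.+1 + b * c s) ->
  tail_sum c' u k = tail_sum c u k + b * tail_sum c u (k + 1).
Proof.
move=> hu h0 hS; rewrite -tail_sumZ //; apply: mfpsP => m; rewrite mfpsD.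
have [N hN] := null_mono k m hu.
have [N' hN'] := null_mono (k + 1) m (nullZ b hu).
rewrite !(@mfps_sumE _ (maxn N N').+1) => [|s|s|s]; first last.
- by move=> /ltnW; rewrite geq_max => /andP[h _]; apply: hN.
- by move=> /ltnW; rewrite geq_max => /andP[h _]; apply: hN.
- by move=> /ltnW; rewrite geq_max => /andP[_ h]; apply: hN'.
rewrite [X in _ = _ + X]big_ord_recr [X in _ + (_ + X)]hN' ?addr0; last first.
  by rewrite /= leq_maxr.
rewrite 2!big_ord_recl h0 -addrA; congr (_ + _).
rewrite -big_split; apply: eq_bigr => s _; rewrite lift0 hS.
by rewrite mulrDl mfpsD -mulrA mulrCA intS addrA.
Qed.

End SeriesTools.

(** * Permutation of variables; coefficients of the generating functions *)

Section PermAction.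
Variables (n : nat) (R : comNzRingType).
Local Notation A := (mfps n R).

(** The action [msym] on polynomials, extended to power series: a negative
    power of [1 + beta u^-1] makes the entries of the matrices infinite. *)
Definition ser_sym (s : {perm 'I_n}) (f : A) : A :=
  MFPS (fun m => f [multinom m (s i) | i < n]).

Lemma mdeg_sym (s : {perm 'I_n}) (m : 'X_{1..n}) :
  mdeg [multinom m (s i) | i < n] = mdeg m.
Proof.
rewrite !mdegE [RHS](reindex_inj (@perm_inj _ s)).
by apply: eq_bigr => i _; rewrite mnmE.
Qed.

Lemma ser_sym_mpoly s p : ser_sym s (mfps_of_mpoly p) = mfps_of_mpoly (msym s p).
Proof. by apply: mfpsP => m /=; rewrite mcoeff_sym. Qed.

Fact ser_sym_zmod s : zmod_morphism (ser_sym s).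
Proof. by move=> f g; apply: mfpsP. Qed.

Fact ser_sym_monoid s : monoid_morphism (ser_sym s).
Proof.
split=> [|f g]; first by rewrite -[1]/(mfps_of_mpoly 1) ser_sym_mpoly rmorph1.
apply: mfpsP => m; set d := (mdeg m).+1.
have trE h (k : 'X_{1..n}) : (mdeg k <= mdeg m)%N ->
    (msym s (mfps_trunc d h))@_k = (mfps_trunc d (ser_sym s h))@_k.
  by move=> hk; rewrite mcoeff_sym !mcoeff_trunc ?mdeg_sym.
rewrite [RHS](@mfps_mulE _ _ d) // [LHS](@mfps_mulE _ _ d) ?mdeg_sym //.
by rewrite -mcoeff_sym rmorphM; apply: mcoeffM_eq; apply: trE.
Qed.

HB.instance Definition _ s := GRing.isZmodMorphism.Build A A (ser_sym s) (ser_sym_zmod s).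
HB.instance Definition _ s := GRing.isMonoidMorphism.Build A A (ser_sym s) (ser_sym_monoid s).

Lemma ser_sym_tail_sum s (c : nat -> A) (u : int -> A) k :
  ser_sym s (tail_sum c u k) = tail_sum (ser_sym s \o c) (ser_sym s \o u) k.
Proof.
have -> : ser_sym s (tail_sum c u k) = mfps_sum (fun t => ser_sym s (c t * u (k + t%:Z))).
  exact: mfpsP.
by congr mfps_sum; apply/funext => t; rewrite rmorphM.
Qed.

(** In a product with [1 + c x_i] the terms of lowest degree are those of [f]. *)
Lemma reg_1pM (i : 'I_n) (c : R) (f : A) :
  (1 + mfps_of_mpoly (c%:MP * 'X_i)) * f = 0 -> f = 0.
Proof.
move=> h; apply: mfpsP => m; rewrite mfps0.
elim: {m}(mdeg m) {-2}m (erefl (mdeg m)) => [|e IH] m em.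
all: have := congr1 (fun g : A => g m) h.
all: rewrite mulrDl mul1r rmorphM -mulrA mfpsD mfps_mulCE mfps_mulXE mfps0.
  by move/eqP: em; rewrite mdeg_eq0 => /eqP->; rewrite mnm0E mulr0 addr0.
case: ifP => mi; last by rewrite mulr0 addr0.
rewrite (IH (m - U_(i))%MM) ?mulr0 ?addr0 //.
have em' : m = (m - U_(i) + U_(i))%MM by rewrite submK // lep1mP -lt0n.
by move: em; rewrite {1}em' mdegD mdeg1 addn1 => -[].
Qed.

(** A difference of two variables is not a zero divisor: on the line
    [k + t (U_i - U_j)] of exponents the coefficients of [f] are constant, and
    the line leaves the orthant. *)
Lemma reg_subX (i j : 'I_n) (f : A) : i != j ->
  mfps_of_mpoly ('X_i - 'X_j) * f = 0 -> f = 0.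
Proof.
move=> ij h; apply: mfpsP => k; rewrite mfps0.
elim: {k}(k j) {-2}k (erefl (k j)) => [|e IH] k ek.
all: have := congr1 (fun g : A => g (k + U_(i))%MM) h.
all: rewrite rmorphB mulrBl mfpsD mfpsN !mfps_mulXE mfps0 !mnmDE !mnm1E eqxx.
all: rewrite (negPf ij) addn0 addn1 addmK ek /=.
  by rewrite subr0.
have -> : f (k + U_(i) - U_(j))%MM = 0.
  by apply: IH; rewrite mnmBE mnmDE !mnm1E eqxx (negPf ij) ek addn0 subn1.
by rewrite subr0.
Qed.

End PermAction.

Section Coefficients.
Variable n : nat.
Local Notation A := (dseries n).
Local Notation toA := (@mfps_of_mpoly (n + n) Zbeta).
Local Notation Au := (mfps 1 A).
Local Notation toAu := (@mfps_of_mpoly 1 A).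
Local Notation be := (toA beta).
Local Notation xx i := (toA (xvar i)).
Local Notation bb j := (toA (bvar j)).
Local Notation mono k := [multinom k%N | _ < 1].

(** The coefficients of the double product in the definition of
    [G^{[p,q]}(u)], without the factor [1 / (1 + beta u^-1)]. *)
Definition Pcoef (p q : nat) : int -> A := laurent_of (Gprod n p q).

Lemma prod_ltS (R : comNzRingType) (F : 'I_n -> R) (p : 'I_n) :
  \prod_(i < n | (i < p.+1)%N) F i = F p * \prod_(i < n | (i < p)%N) F i.
Proof.
rewrite (bigD1 p) //=; congr (_ * _); apply: eq_bigl => i.
by rewrite -val_eqE /=; lia.
Qed.

Lemma Pcoef_neg p q k : k < 0 -> Pcoef p q k = 0. Proof. by case: k. Qed.

Lemma mul_u (f : Au) k : (toAu 'X_ord0 * f) (mono k) = laurent_of f (k%:Z - 1).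
Proof.
rewrite mfps_mulXE mnmE; case: k => [//|k].
rewrite (_ : k.+1%:Z - 1 = k%:Z) /=; [congr (f _) | by lia].
by apply/mnmP => i; rewrite mnmBE !mnmE (ord1 i) eqxx subn1.
Qed.

Lemma Pcoef_x (p : 'I_n) q k :
  Pcoef p.+1 q k - xx p * Pcoef p.+1 q (k - 1) = (1 + be * xx p) * Pcoef p q k.
Proof.
case: k => [k|k]; last by rewrite !Pcoef_neg ?mulr0 ?subr0 //; lia.
have E : toAu (1 - (xx p) *: 'X_ord0) * Gprod n p.+1 q
    = toAu (toA (1 + beta * xvar p))%:MP * Gprod n p q.
  rewrite /Gprod prod_ltS.
  have aux (a g Q S t : Au) : g * t = 1 -> t * (a * g * Q * S) = a * (Q * S).
    move=> gt1; rewrite -[RHS]mul1r -gt1 -!mulrA.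
    by rewrite [in RHS](mulrCA g t) [in RHS](mulrCA g a).
  exact/aux/geomP.
have <- : toA (1 + beta * xvar p) = 1 + be * xx p by rewrite rmorphD rmorph1 rmorphM.
have -> : toA (1 + beta * xvar p) * Pcoef p q k%:Z
    = (toAu (1 - (xx p) *: 'X_ord0) * Gprod n p.+1 q) (mono k).
  by rewrite E mfps_mulCE.
rewrite rmorphB rmorph1 mulrBl mul1r mfpsD mfpsN -mul_mpolyC rmorphM -mulrA.
by rewrite mfps_mulCE mul_u.
Qed.

Lemma rmorph_1pMD (S T : pzRingType) (h : {rmorphism S -> T}) x y z w :
  h (1 + x * (y + z)) * w = w + h x * (h y * w) + h x * (h z * w).
Proof.
by rewrite rmorphD rmorph1 rmorphM rmorphD mulrDl mul1r mulrDr mulrDl addrA !mulrA.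
Qed.

Lemma Pcoef_b p (q : 'I_n) k :
  Pcoef p q.+1 k = (1 + be * bb q) * Pcoef p q k + bb q * Pcoef p q (k - 1).
Proof.
case: k => [k|k]; last by rewrite !Pcoef_neg ?mulr0 ?addr0 //; lia.
have -> : Pcoef p q.+1 k = (toAu (1 + (bb q)%:MP * (be%:MP + 'X_ord0)) * Gprod n p q) (mono k).
  by congr (_ (mono k)); rewrite /Gprod prod_ltS mulrCA.
rewrite rmorph_1pMD [LHS]mfpsD [X in X + _ = _]mfpsD.
rewrite [X in _ + X + _ = _]mfps_mulCE [X in _ + _ * X + _ = _]mfps_mulCE.
rewrite [X in _ + X = _]mfps_mulCE mul_u.
by rewrite mulrDl mul1r mulrCA mulrA.
Qed.

Lemma Pcoef00 k : Pcoef 0 0 k = (k == 0)%:R.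
Proof.
have e : Gprod n 0 0 = 1 by rewrite /Gprod !big_pred0 ?mulr1.
rewrite /Pcoef e; case: k => [k|k] //; rewrite [LHS]mcoeff1; congr (_%:R); congr nat_of_bool.
apply/eqP/eqP => [/mnmP /(_ ord0)|[->]]; first by rewrite !mnmE => ->.
by apply/mnmP => i; rewrite !mnmE.
Qed.

Lemma Pcoef_large q k : (q <= n)%N -> q%:Z < k -> Pcoef 0 q k = 0.
Proof.
elim: q k => [|q IH] k hq hk; first by rewrite Pcoef00 gt_eqF.
rewrite (Pcoef_b 0 (Ordinal hq)) /= !IH ?mulr0 ?addr0 //; lia.
Qed.

Lemma Pcoef_null p q : (p <= n)%N -> (q <= n)%N -> null (Pcoef p q).
Proof.
move=> + hq; elim: p => [|p IH] hp.
  by move=> e; exists q.+1%:Z => k hk; rewrite Pcoef_large //; lia.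
have hP k : Pcoef p.+1 q k = xx (Ordinal hp) * Pcoef p.+1 q (k - 1)
    + (1 + be * xx (Ordinal hp)) * Pcoef p q k.
  by rewrite -(Pcoef_x (Ordinal hp)) addrC subrK.
elim=> [|e [M hM]]; first by exists 0.
have [M' hM'] := IH (ltnW hp) e.+1.
exists (Num.max (M + 1) M') => k; rewrite ge_max => /andP[h h'].
rewrite hP; apply: ord_geD; last by apply: ord_geMl; apply: hM'.
by rewrite -add1n; apply: ord_geM; [apply: ord_geX | apply: hM; lia].
Qed.

(** The coefficients of [(1 + beta u^-1)^a] times the series [G^{[p,q]}(u)]. *)
Definition Gpow (a : int) (p q : nat) : int -> A :=
  tail_sum (fun s => (gbinom a s)%:~R * be ^+ s) (Gseries n p q).

Lemma Gseries_tail p q :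
  Gseries n p q = tail_sum (fun s => (- be) ^+ s) (Pcoef p q).
Proof.
apply/funext => k; rewrite /Gseries /laurent_mul mfps_sum_int.
  congr mfps_sum; apply/funext => s.
  by rewrite /inv_1_beta_uV lerNl oppr0 lez_nat /= opprK abszN absz_nat.
by move=> j hj; rewrite /inv_1_beta_uV leNgt hj mul0r.
Qed.

Lemma gbinom0 a : gbinom a 0 = 1.
Proof. by rewrite /gbinom big_ord0 fact0 divz1. Qed.

End Coefficients.

(** * Recursions and symmetry of the entries *)

Section Binomial.

Definition falling (a : int) (s : nat) : int := \prod_(t < s) (a - t%:Z).

Lemma falling_pascal a s :
  falling (a + 1) s.+1 = falling a s.+1 + s.+1%:Z * falling a s.
Proof.
rewrite /falling big_ord_recl big_ord_recr /= subr0.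
have -> : \prod_(i < s) (a + 1 - (bump 0 i)%:Z) = \prod_(i < s) (a - i%:Z).
  by apply: eq_bigr => i _; rewrite /bump /= add1n; lia.
by rewrite intS; ring.
Qed.

(** Both directions of the induction on [a] use that [falling a s.+1] changes by
    [s.+1 * falling a s] when [a] moves by one. *)
Lemma fact_dvd_falling a s : ((s`!)%:Z %| falling a s)%Z.
Proof.
elim: s a => [|s IH] a; first by rewrite /falling big_ord0.
have hd b : ((s.+1`!)%:Z %| s.+1%:Z * falling b s)%Z.
  by rewrite factS PoszM; apply: dvdz_mul.
elim: a => [|k IHk|k IHk].
- by rewrite /falling big_ord_recl subr0 mul0r dvdz0.
- by rewrite intS addrC falling_pascal rpredD.
have := falling_pascal (- (k.+1)%:Z) s.
rewrite (_ : - k.+1%:Z + 1 = - k%:Z) ?intS; last by lia.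
by move/eqP; rewrite -subr_eq => /eqP <-; rewrite rpredB.
Qed.

Lemma gbinom_pascal a s : gbinom (a + 1) s.+1 = gbinom a s.+1 + gbinom a s.
Proof.
have gK b t : gbinom b t * (t`!)%:Z = falling b t.
  by rewrite divzK ?fact_dvd_falling.
apply: (@mulIf _ (s.+1`!)%:Z); first by rewrite eqz_nat -lt0n fact_gt0.
by rewrite mulrDl !gK falling_pascal -(gK a s) factS PoszM; ring.
Qed.

Lemma gbinom0n s : gbinom 0 s.+1 = 0.
Proof. by rewrite /gbinom big_ord_recl subr0 mul0r div0z. Qed.

End Binomial.

Section Rows.
Variable n : nat.
Local Notation A := (dseries n).
Local Notation toA := (@mfps_of_mpoly (n + n) Zbeta).
Local Notation be := (toA beta).
Local Notation xx i := (toA (xvar i)).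
Local Notation bb j := (toA (bvar j)).

Lemma tail_sum1 (c : nat -> A) u k : c 0%N = 1 -> (forall s, c s.+1 = 0) ->
  tail_sum c u k = u k.
Proof.
move=> c0 cS; apply: mfpsP => m; rewrite (@mfps_sumE _ _ _ 1) => [|[|s] // _].
  by rewrite big_ord1 c0 mul1r addr0.
by rewrite cS mul0r.
Qed.

(** A relation [(1 - x u) U(u) = y V(u)] between generating functions survives
    multiplication by a power series in [u^-1]. *)
Lemma tail_sum_rel c (u v : int -> A) x y k : null u -> null v ->
  (forall k, u k - x * u (k - 1) = y * v k) ->
  tail_sum c u k - x * tail_sum c u (k - 1) = y * tail_sum c v k.
Proof.
move=> hu hv h; rewrite -(tail_sumZ _ _ _ hv).
have -> : (fun j => y * v j) = (fun j => u j + - x * u (j - 1)).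
  by apply/funext => j; rewrite -h mulNr.
have hs := null_shift (-1) hu.
by rewrite (tail_sumD _ _ hu (nullZ _ hs)) (tail_sumZ _ _ _ hs) tail_sum_shift mulNr.
Qed.

Lemma Gseries_null p q : (p <= n)%N -> (q <= n)%N -> null (Gseries n p q).
Proof. by move=> hp hq; rewrite Gseries_tail; apply/null_tail_sum/Pcoef_null. Qed.

Lemma Gseries_T p q k : (p <= n)%N -> (q <= n)%N ->
  Pcoef n p q k = Gseries n p q k + be * Gseries n p q (k + 1).
Proof.
move=> hp hq; rewrite Gseries_tail.
rewrite -(tail_sum_step (c' := fun s => (s == 0%N)%:R)) ?tail_sum1 //.
  exact: Pcoef_null.
by move=> s; rewrite exprS mulNr addrC subrr.
Qed.

Lemma Gpow0 p q k : Gpow n 0 p q k = Gseries n p q k.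
Proof.
by apply: tail_sum1 => [|s]; rewrite ?gbinom0 ?mul1r // gbinom0n mul0r.
Qed.

Lemma Gpow_T a p q k : (p <= n)%N -> (q <= n)%N ->
  Gpow n (a + 1) p q k = Gpow n a p q k + be * Gpow n a p q (k + 1) :> A.
Proof.
move=> hp hq; apply: tail_sum_step; first exact: Gseries_null.
  by rewrite !gbinom0.
by move=> s; rewrite gbinom_pascal intrD exprS; ring.
Qed.

Lemma Gpow_x a (p : 'I_n) q k : (q <= n)%N ->
  Gpow n a p.+1 q k - xx p * Gpow n a p.+1 q (k - 1) = (1 + be * xx p) * Gpow n a p q k.
Proof.
move=> hq; have hp := ltn_ord p; have hp' := ltnW hp.
apply: tail_sum_rel => [||j]; try exact: Gseries_null.
rewrite !Gseries_tail; apply: tail_sum_rel; try exact: Pcoef_null.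
by move=> {}j; apply: Pcoef_x.
Qed.

Lemma Gpow_large a q k : (q <= n)%N -> q%:Z < k -> Gpow n a 0 q k = 0 :> A.
Proof.
have tail0 c (u : int -> A) : (forall j, q%:Z < j -> u j = 0) ->
    forall j, q%:Z < j -> tail_sum c u j = 0.
  move=> hu j hj; apply: mfpsP => m; rewrite (@mfps_sumE _ _ _ 0) ?big_ord0 //.
  by move=> s _; rewrite hu ?mulr0 //; lia.
move=> hq; apply: (tail0) => j; rewrite Gseries_tail; apply: (tail0).
by move=> {}j; apply: Pcoef_large.
Qed.

(** Two consecutive one-variable recursions give one that is symmetric in the
    two variables. *)
Lemma two_step_rec (T : comPzRingType) (x x' y y' P0 P1 P2 Q0 Q1 S : T) :
  P0 = y' * Q0 + x' * P1 -> P1 = y' * Q1 + x' * P2 -> Q0 - x * Q1 = y * S ->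
  P0 = (x + x') * P1 - x * x' * P2 + y * y' * S.
Proof.
move=> -> e1; rewrite [X in _ = _ + X]mulrAC => <-.
have ex : x * P1 = x * x' * P2 + x * y' * Q1 by rewrite e1 mulrDr addrC !mulrA.
by rewrite [X in _ = X - _ + _]mulrDl ex; ring.
Qed.

Section MorphismIdentities.
Variables (S T : comPzRingType) (h : {rmorphism S -> T}).

Lemma rmorph_lin2 c y z u v :
  h ((1 + c * y) * u + z * v) = (1 + h c * h y) * h u + h z * h v.
Proof. by rewrite rmorphD !rmorphM rmorphD rmorph1 rmorphM. Qed.

Lemma rmorph_lin3 c x x' u v w :
  h ((x + x') * u - x * x' * v + (1 + c * x) * (1 + c * x') * w)
  = (h x + h x') * h u - h x * h x' * h v + (1 + h c * h x) * (1 + h c * h x') * h w.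
Proof. by rewrite rmorphD rmorphB !rmorphM !rmorphD rmorph1 !rmorphM. Qed.

End MorphismIdentities.

Lemma divided_difference (S : comPzRingType) (h : {rmorphism S -> S}) c x x' u v w :
  h c = c -> h x' = x -> h u = u -> h v = v -> u - x' * v = (1 + c * x') * w ->
  (x - x') * v = (1 + c * x') * w - (1 + c * x) * h w.
Proof.
move=> hc hx hu hv e; have := congr1 h e.
rewrite rmorphB !rmorphM rmorphD rmorph1 rmorphM hc hx hu hv => <-.
by rewrite -e; ring.
Qed.

Section Symmetry.
Variables a a' : 'I_n.
Hypothesis aa' : a' = a.+1 :> nat.
Local Notation fs := (ser_sym (tperm (lshift n a) (lshift n a'))).

Lemma ser_sym_beta : fs be = be.
Proof. by rewrite ser_sym_mpoly -[msym _]/(s_act a a') s_act_beta. Qed.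
Lemma ser_sym_x k : fs (xx k) = xx (tperm a a' k).
Proof. by rewrite ser_sym_mpoly -[msym _]/(s_act a a') s_act_x. Qed.
Lemma s_act_b j : s_act a a' (bvar j) = bvar j.
Proof.
rewrite /s_act /msym mmapX mmap1U tpermD //.
all: by rewrite -val_eqE /= ltn_eqF // (leq_trans (ltn_ord _)) ?leq_addr.
Qed.
Lemma ser_sym_b j : fs (bb j) = bb j.
Proof. by rewrite ser_sym_mpoly -[msym _]/(s_act a a') s_act_b. Qed.

(** By induction on the number [p] of variables: the recursion that adds [x_p]
    is fixed by the exchange unless [x_p] is one of the exchanged variables, and
    then adding both of them is a symmetric recursion. *)
Lemma Pcoef_sym p q k : (p <= n)%N -> (q <= n)%N -> p <> a.+1 ->
  fs (Pcoef n p q k) = Pcoef n p q k.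
Proof.
move=> hp + hpa; elim: q k => [|q IHq] k hq; last first.
  have hq' := ltnW hq.
  by rewrite (Pcoef_b p (Ordinal hq)) rmorph_lin2 /= ser_sym_b ser_sym_beta (IHq k) // (IHq (k - 1)).
elim/ltn_ind: p k hp hpa => -[|p] IHp k hp hpa; first by rewrite Pcoef00 rmorph_nat.
pose P := Pcoef n p.+1 0.
suff h N : forall k, k < N%:Z -> fs (P k) = P k by apply: (h `|k|.+1%N); lia.
elim: N => [|N IHN] {}k hk.
  by rewrite /P Pcoef_neg ?rmorph0 //; lia.
have hN l : l < k -> fs (P l) = P l by move=> hl; apply: IHN; lia.
have PE l : P l = (1 + be * xx (Ordinal hp)) * Pcoef n p 0 l
    + xx (Ordinal hp) * P (l - 1).
  by rewrite -(Pcoef_x (Ordinal hp)) subrK.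
have hN1 : fs (P (k - 1)) = P (k - 1) by apply: hN; lia.
have [pa|/eqP pa] := eqVneq p a.+1; last first.
  have hQ : fs (Pcoef n p 0 k) = Pcoef n p 0 k by apply: IHp => //; apply: ltnW.
  have hx : fs (xx (Ordinal hp)) = xx (Ordinal hp).
    by rewrite ser_sym_x tpermD // -val_eqE /=; lia.
  by rewrite PE rmorph_lin2 /= hx hN1 hQ ser_sym_beta.
have ea' : Ordinal hp = a' by apply: val_inj; rewrite /= pa aa'.
have P2 : P k = (xx a + xx a') * P (k - 1) - xx a * xx a' * P (k - 1 - 1)
    + (1 + be * xx a) * (1 + be * xx a') * Pcoef n a 0 k.
  have h := Pcoef_x a 0 k; rewrite -pa in h.
  have h1 := PE k; have h2 := PE (k - 1); rewrite ea' in h1 h2.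
  exact: two_step_rec h1 h2 h.
have hQ : fs (Pcoef n a 0 k) = Pcoef n a 0 k by apply: IHp; lia.
have hN2 : fs (P (k - 1 - 1)) = P (k - 1 - 1) by apply: hN; lia.
rewrite P2 rmorph_lin3 /= hQ hN1 hN2 ser_sym_beta (ser_sym_x a) (ser_sym_x a') tpermL tpermR.
by rewrite (addrC (xx a')) (mulrC (xx a')) (mulrC (1 + _ * xx a')).
Qed.

Lemma Gpow_sym c p q k : (p <= n)%N -> (q <= n)%N -> p <> a.+1 ->
  fs (Gpow n c p q k) = Gpow n c p q k.
Proof.
move=> hp hq hpa; rewrite /Gpow ser_sym_tail_sum.
have -> : fs \o (fun s => (gbinom c s)%:~R * be ^+ s)
    = (fun s => (gbinom c s)%:~R * be ^+ s).
  by apply/funext => s /=; rewrite rmorphM rmorph_int rmorphXn /= ser_sym_beta.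
have -> // : fs \o Gseries n p q = Gseries n p q.
apply/funext => s; rewrite [LHS]/= Gseries_tail ser_sym_tail_sum.
have -> : fs \o (fun s => (- be) ^+ s) = (fun s => (- be) ^+ s).
  by apply/funext => t /=; rewrite rmorphXn rmorphN /= ser_sym_beta.
have -> // : fs \o Pcoef n p q = Pcoef n p q.
by apply/funext => t; apply: Pcoef_sym.
Qed.

(** The divided difference of [(1 + beta x_a) / (1 - x_a u)] is [u] times the product of
    the factors of both variables; all other factors are symmetric. *)
Lemma Gpow_pi c q k : (q <= n)%N ->
  (xx a - xx a') * Gpow n c a'.+1 q (k - 1)
  = (1 + be * xx a') * Gpow n c a.+1 q k - (1 + be * xx a) * fs (Gpow n c a.+1 q k).
Proof.
move=> hq; have na : a'.+1 <> a.+1 by rewrite aa'; lia.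
have h := Gpow_x c a' k hq; rewrite [in RHS]aa' in h.
apply: (divided_difference (h := fs) (u := Gpow n c a'.+1 q k)) (h).
- exact: ser_sym_beta.
- by rewrite [LHS]ser_sym_x tpermR.
- exact: Gpow_sym.
- exact: Gpow_sym.
Qed.

End Symmetry.

End Rows.

(** * Determinants and column operations *)

Section ColumnOperations.
Variable R : comNzRingType.

(** [M'] is [M] times a unitriangular matrix, upper if the columns [f j] precede
    [j], and lower if they follow it. *)
Lemma det_col_ops d (M M' : 'M[R]_d) (c : 'I_d -> R) (f : 'I_d -> 'I_d) :
  (forall i j, M' i j = M i j + c j * M i (f j)) ->
  (forall j, c j = 0 \/ (f j < j)%N) \/ (forall j, c j = 0 \/ (j < f j)%N) ->
  \det M' = \det M.
Proof.
move=> hM hf.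
pose C := \matrix_(l, j) ((l == j)%:R + c j * (l == f j)%:R) : 'M[R]_d.
have pick (F : 'I_d -> R) j : \sum_l F l * (l == j)%:R = F j.
  rewrite (bigD1 j) //= eqxx mulr1 big1 ?addr0 // => l /negPf->.
  by rewrite mulr0.
have -> : M' = M *m C.
  apply/matrixP => i j; rewrite hM !mxE -[in LHS](pick (M i) j) -[in LHS](pick (M i) (f j)).
  rewrite mulr_sumr -big_split; apply: eq_bigr => l _.
  by rewrite mxE mulrDr mulrCA.
rewrite det_mulmx [X in _ * X](_ : _ = 1) ?mulr1 //.
have cf j : c j * (j == f j)%:R = 0.
  case: (eqVneq j (f j)) => [e|_]; last by rewrite mulr0.
  by case: hf => /(_ j) []; rewrite -?e ?ltnn // => ->; rewrite mul0r.
have diag j : C j j = 1 by rewrite mxE eqxx cf addr0.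
have off l j : l != j -> C l j = c j * (l == f j)%:R.
  by move=> /negPf lj; rewrite mxE lj add0r.
case: hf => hf; last first.
  rewrite det_trig ?big1 //; apply/is_trig_mxP => l j lj.
  have nlj : l != j by rewrite -val_eqE /= ltn_eqF.
  rewrite off //; case: (hf j) => [->|hj]; first by rewrite mul0r.
  by rewrite -val_eqE /= ltn_eqF ?mulr0 // (ltn_trans lj).
rewrite -det_tr det_trig => [|]; first by rewrite big1 // => j _; rewrite mxE.
apply/is_trig_mxP => l j lj; have njl : j != l by rewrite -val_eqE /= gtn_eqF.
rewrite mxE off //.
case: (hf l) => [->|hj]; first by rewrite mul0r.
by rewrite -val_eqE /= gtn_eqF ?mulr0 // (ltn_trans hj).
Qed.

(** Passing from the first matrix to the second: with [T = 1 + be u^-1], the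
    entry [(i, j)] of the second is the entry of the first acted on by
    [T^(d-1-j)], and each factor [T] adds [be] times the next column. *)
Lemma det_pascal d (be : R) (F : 'I_d -> nat -> int -> R) (mu : 'I_d -> int) :
  (forall i t k, F i t.+1 k = F i t k + be * F i t (k + 1)) ->
  \det (\matrix_(i < d, j < d) F i 0%N (mu i + j%:Z))
  = \det (\matrix_(i < d, j < d) F i (d.-1 - j)%N (mu i + j%:Z)).
Proof.
move=> hF; pose N t := \matrix_(i < d, j < d) F i (minn t (d.-1 - j)) (mu i + j%:Z).
have step t : \det (N t) = \det (N 0%N).
  elim: t => // t <-.
  apply: (@det_col_ops _ _ _ (fun j => if (t < d.-1 - j)%N then be else 0)
            (fun j => insubd j j.+1)) => [i j|].
    rewrite !mxE; case: ltnP => tj; last by rewrite mul0r addr0 !(minn_idPr _) // ltnW.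
    have ej : insubd j j.+1 = j.+1 :> nat by rewrite val_insubd ifT //; lia.
    by rewrite ej (minn_idPl _) // hF !(minn_idPl _) ?intS; [rewrite addrCA (addrC 1)| lia..].
  right=> j; case: ltnP => tj; [right | by left].
  by rewrite val_insubd ifT //; lia.
transitivity (\det (N d)).
  by rewrite step; congr (\det _); apply/matrixP => i j; rewrite !mxE min0n.
congr (\det _); apply/matrixP => i j; rewrite !mxE (minn_idPr _) //.
by rewrite (leq_trans (leq_subr _ _)) ?leq_pred.
Qed.

Variable x : nat -> R.

(** [Dx t u] is [(1 - x_(t-1) U) ... (1 - x_0 U) u], where [U] shifts to the
    right: it removes [t] of the variables from the denominator of the
    generating function of [u]. *)
Fixpoint Dx (t : nat) (u : int -> R) (k : int) : R :=
  if t is t'.+1 then Dx t' u k - x t' * Dx t' u (k - 1) else u k.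

Lemma Dx_lin t (u v : int -> R) a k :
  Dx t (fun k => u k + a * v k) k = Dx t u k + a * Dx t v k.
Proof. by elim: t k => [|t IH] k //=; rewrite !IH; ring. Qed.

Lemma Dx_shift t (u : int -> R) m k : Dx t (fun k => u (k + m)) k = Dx t u (k + m).
Proof. by elim: t k => [|t IH] k //=; rewrite !IH addrAC. Qed.

Lemma Dx0 t k : Dx t (fun=> 0) k = 0.
Proof. by elim: t k => [|t IH] k //=; rewrite !IH mulr0 subrr. Qed.

Lemma DxZ t (u : int -> R) a k : Dx t (fun k => a * u k) k = a * Dx t u k.
Proof.
rewrite -[RHS]add0r -(Dx0 t k) -Dx_lin; congr Dx; apply/funext => l.
by rewrite add0r.
Qed.

Lemma eq_Dx t (u v : int -> R) k : u =1 v -> Dx t u k = Dx t v k.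
Proof. by move=> /funext ->. Qed.

(** [f p] is built up to the last variable [x_(p-1)] while [Dx] removes [x_0]
    first; this makes no difference because the factors [1 - x_t U] commute. *)
Lemma Dx_all p (f : nat -> int -> R) (y : nat -> R) k :
  (forall t k, (t < p)%N -> f t.+1 k - x t * f t.+1 (k - 1) = y t * f t k) ->
  Dx p (f p) k = (\prod_(t < p) y t) * f 0%N k.
Proof.
elim: p k => [|p IH] k hf; first by rewrite big_ord0 mul1r.
rewrite /= -Dx_shift -mulNr -Dx_lin.
under eq_Dx => l do rewrite mulNr hf //.
rewrite DxZ IH => [|t l tp]; last by rewrite hf // ltnW.
by rewrite big_ord_recr /=; ring.
Qed.

(** Column operations that remove more and more variables turn the matrix
    into a lower triangular one. *)
Lemma det_remove_vars d (f : 'I_d -> int -> R) (mu : 'I_d -> int) :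
  (forall (i : 'I_d) k, mu i + i%:Z < k -> Dx i.+1 (f i) k = 0) ->
  \det (\matrix_(i < d, j < d) f i (mu i + j%:Z))
  = \prod_(i < d) Dx i (f i) (mu i + i%:Z).
Proof.
move=> hf; pose N t := \matrix_(i < d, j < d) Dx (minn t j) (f i) (mu i + j%:Z).
have step t : \det (N t) = \det (N 0%N).
  elim: t => // t <-.
  apply: (@det_col_ops _ _ _ (fun j => if (t < j)%N then - x t else 0)
            (fun j => insubd j j.-1)) => [i j|].
    rewrite !mxE; case: ltnP => tj; last by rewrite mul0r addr0 !(minn_idPr _) // ltnW.
    have ej : insubd j j.-1 = j.-1 :> nat.
      by rewrite val_insubd (leq_ltn_trans (leq_pred j)).
    rewrite ej (minn_idPl _) // !(minn_idPl _) /=; [|lia..].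
    by rewrite mulNr; congr (_ - _ * Dx _ _ _); lia.
  left=> j; case: ltnP => tj; [right | by left].
  by rewrite val_insubd (leq_ltn_trans (leq_pred j)) //; lia.
have zero (i : 'I_d) s k : mu i + i%:Z + s%:Z < k -> Dx (i.+1 + s) (f i) k = 0.
  elim: s k => [|s IH] k hk; first by rewrite addn0 hf //; lia.
  rewrite addnS -[LHS]/(Dx (i.+1 + s) _ k - x (i.+1 + s) * Dx (i.+1 + s) _ (k - 1)).
  by rewrite !IH ?mulr0 ?subrr //; lia.
transitivity (\det (N d)).
  by rewrite step; congr (\det _); apply/matrixP => i j; rewrite !mxE min0n.
rewrite det_trig => [|]; first by apply: eq_bigr => i _; rewrite mxE (minn_idPr _) // ltnW.
apply/is_trig_mxP => i j ij; rewrite mxE (minn_idPr _); last exact: ltnW.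
by rewrite -(subnKC ij) zero //; lia.
Qed.

End ColumnOperations.

(** * The determinant of a flagging set *)

Section FlagDeterminant.
Variable n : nat.
Local Notation A := (dseries n).
Local Notation toA := (@mfps_of_mpoly (n + n) Zbeta).
Local Notation be := (toA beta).
Local Notation xx i := (toA (xvar i)).
Local Notation bb j := (toA (bvar j)).

(** The first matrix, in terms of the flagging set alone: row [i], counted from
    [0], has index [q_i - p_i + 1 + j] since the part of [lambda(w)] that belongs
    to it is [q_i - p_i + i + 1]. *)
Definition flag_mx d (p q : 'I_d -> nat) : 'M[A]_d :=
  \matrix_(i < d, j < d)
    Gpow n (i.+1%:Z - d%:Z) (p i) (q i) ((q i)%:Z - (p i)%:Z + 1 + j%:Z).

Lemma det_row_semilin (T : comNzRingType) (h : {rmorphism T -> T}) d (k : 'I_d)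
    (M M' : 'M[T]_d) y z z' :
  (forall i j, i != k -> M' i j = M i j) ->
  (forall i j, i != k -> h (M i j) = M i j) ->
  (forall j, y * M' k j = z * M k j - z' * h (M k j)) ->
  y * \det M' = z * \det M - z' * h (\det M).
Proof.
move=> h' h'' hk; pose W := \matrix_(i, j) (if i == k then y * M' i j else M i j).
have rowE (N : 'M[T]_d) : (forall i j, i != k -> N i j = M i j) -> row' k N = row' k W.
  move=> hN; apply/matrixP => i j; rewrite !mxE.
  have nk : lift k i != k by rewrite eq_sym neq_lift.
  by rewrite (negPf nk) hN.
have e1 : \det W = y * \det M' + 0 * \det M'.
  apply: (determinant_multilinear (i0 := k)); try exact: rowE.
  by apply/rowP => j; rewrite !mxE eqxx mul0r addr0.
have e2 : \det W = z * \det M + (- z') * \det (map_mx h M).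
  apply: (determinant_multilinear (i0 := k)); first 1 last.
  - exact: rowE.
  - by apply: rowE => i j ik; rewrite mxE h''.
  by apply/rowP => j; rewrite !mxE eqxx hk mulNr.
by rewrite mul0r addr0 in e1; rewrite -e1 e2 mulNr det_map_mx.
Qed.

(** Only one row of the matrix involves the series with variables
    [x_1, ..., x_a], and the others are symmetric in [x_a] and [x_(a+1)]; so the
    divided difference acts on that row alone. *)
Lemma flag_det_pi d (p p' q : 'I_d -> nat) (k : 'I_d) (a a' : 'I_n) :
  a' = a.+1 :> nat -> (forall i, (p i <= n)%N) -> (forall i, (q i <= n)%N) ->
  p k = a.+1 -> p' k = a.+2 ->
  (forall i, i != k -> p i <> a.+1 /\ p' i = p i) ->
  (xx a - xx a') * \det (flag_mx p' q)
  = (1 + be * xx a') * \det (flag_mx p q)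
    - (1 + be * xx a) * ser_sym (tperm (lshift n a) (lshift n a')) (\det (flag_mx p q)).
Proof.
move=> aa' hp hq pk pk' hoth; apply: (@det_row_semilin _ _ _ k) => [i j ik|i j ik|j].
- by rewrite [LHS]mxE [RHS]mxE (hoth i ik).2.
- by rewrite mxE; apply: Gpow_sym => //; apply: (hoth i ik).1.
rewrite [X in _ * X = _]mxE (mxE _ _ k j) pk pk' -aa'.
set c := _ - d%:Z; have := Gpow_pi aa' c ((q k)%:Z - a.+1%:Z + 1 + j%:Z) (hq k).
rewrite -aa' => <-; congr (_ * Gpow n _ _ _ _).
by lia.
Qed.

(** [x_(i+1)] as a function of a natural number, to iterate over the variables. *)
Definition xnat (i : nat) : A := if insub i is Some o then xx o else 0.

Lemma xnatE (i : 'I_n) : xnat i = xx i. Proof. by rewrite /xnat valK. Qed.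

Lemma reg_1p_beta_x i (f : A) : (1 + be * xnat i) * f = 0 -> f = 0.
Proof.
rewrite /xnat; case: insub => [o|]; last by rewrite mulr0 addr0 mul1r.
by rewrite -rmorphM; apply: reg_1pM.
Qed.

Lemma Dx_neg t (u : int -> A) : (forall k, k < 0 -> u k = 0) ->
  forall k, k < 0 -> Dx xnat t u k = 0.
Proof.
move=> hu; elim: t => [|t IH] k hk /=; first exact: hu.
by rewrite !IH ?mulr0 ?subrr //; lia.
Qed.

Section Diagonal.
Variable i : 'I_n.
Local Notation xi := (xnat i).
Local Notation Pi := (\prod_(t < i.+1) (1 + be * xnat t)).

Lemma Dx_Gpow c q k : (q <= n)%N ->
  Dx xnat i (Gpow n c i.+1 q) k - xi * Dx xnat i (Gpow n c i.+1 q) (k - 1)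
  = Pi * Gpow n c 0 q k.
Proof.
move=> hq; apply: (@Dx_all _ xnat i.+1 (fun p => Gpow n c p q)
    (fun t => 1 + be * xnat t)) => t l ti.
have tn : (t < n)%N by apply: leq_trans ti _.
by rewrite -[t]/(nat_of_ord (Ordinal tn)) xnatE Gpow_x.
Qed.

Lemma Dx_Pcoef q k : (q <= n)%N ->
  Dx xnat i (Pcoef n i.+1 q) k - xi * Dx xnat i (Pcoef n i.+1 q) (k - 1)
  = Pi * Pcoef n 0 q k.
Proof.
move=> hq; apply: (@Dx_all _ xnat i.+1 (fun p => Pcoef n p q)
    (fun t => 1 + be * xnat t)) => t l ti.
have tn : (t < n)%N by apply: leq_trans ti _.
by rewrite -[t]/(nat_of_ord (Ordinal tn)) xnatE Pcoef_x.
Qed.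

(** With [x_i] as the only variable left, one more column [b_j] multiplies the top
    coefficient by [(1 + beta b_j) x_i + b_j]. *)
Lemma Dx_Pcoef_top q : (q <= n)%N ->
  Dx xnat i (Pcoef n i.+1 q) q%:Z
  = Pi * \prod_(j < n | (j < q)%N) (xi + bb j + be * xi * bb j).
Proof.
elim: q => [|q IH] hq.
  have := Dx_Pcoef 0 (leq0n n); rewrite Pcoef00 mulr1 => <-.
  rewrite big_pred0 // mulr1 [X in _ = _ - _ * X]Dx_neg ?mulr0 ?subr0 //.
  exact: Pcoef_neg.
have top : Dx xnat i (Pcoef n i.+1 q) q.+1%:Z = xi * Dx xnat i (Pcoef n i.+1 q) q%:Z.
  apply/eqP; rewrite -subr_eq0 -(_ : q.+1%:Z - 1 = q%:Z); last by lia.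
  by rewrite (Dx_Pcoef _ (ltnW hq)) (Pcoef_large (ltnW hq)) ?mulr0 //; lia.
pose o := Ordinal hq; rewrite (prod_ltS _ o).
have eq1 : q.+1%:Z - 1 = q%:Z by lia.
have -> : Dx xnat i (Pcoef n i.+1 q.+1) q.+1%:Z
    = (1 + be * bb o) * Dx xnat i (Pcoef n i.+1 q) q.+1%:Z
      + bb o * Dx xnat i (fun k => Pcoef n i.+1 q (k - 1)) q.+1%:Z.
  by rewrite -DxZ -Dx_lin; apply: eq_Dx => l; rewrite (Pcoef_b _ o).
rewrite Dx_shift eq1 top IH; last exact: ltnW.
set S := \prod_(j < n | _) _; set P := \prod_(t < _) _; ring.
Qed.

(** Each factor [(1 + beta u^-1)^-1] evaluates to [(1 + beta x_i)^-1] in the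
    top coefficient, where [u^-1] acts as [x_i]. *)
Lemma Dx_Gpow_top N q : (q <= n)%N ->
  (1 + be * xi) ^+ N.+1 * Dx xnat i (Gpow n (- N%:Z) i.+1 q) q%:Z
  = Pi * \prod_(j < n | (j < q)%N) (xi + bb j + be * xi * bb j).
Proof.
move=> hq.
have top c : Dx xnat i (Gpow n c i.+1 q) (q%:Z + 1) = xi * Dx xnat i (Gpow n c i.+1 q) q%:Z.
  apply/eqP; rewrite -subr_eq0 -[X in _ * Dx _ _ _ X](addrK 1 q%:Z).
  by rewrite Dx_Gpow // Gpow_large ?mulr0 //; lia.
elim: N => [|N IH].
  rewrite -Dx_Pcoef_top // oppr0 expr1 mulrDl mul1r -mulrA -top -Dx_shift -Dx_lin.
  by apply: eq_Dx => l; rewrite !Gpow0 -Gseries_T.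
rewrite -IH exprSr -mulrA; congr (_ * _).
rewrite mulrDl mul1r -mulrA -top -Dx_shift -Dx_lin.
have eN : - N%:Z = - N.+1%:Z + 1 by lia.
by apply: eq_Dx => l; rewrite eN Gpow_T.
Qed.

End Diagonal.

Lemma prod_triangle (T : comPzRingType) (z : nat -> T) d :
  \prod_(i < d) \prod_(t < i.+1) z t = \prod_(i < d) z i ^+ (d - i).
Proof.
elim: d => [|d IH]; first by rewrite !big_ord0.
rewrite big_ord_recr IH big_ord_recr /= [RHS]big_ord_recr /= subSnn expr1 mulrA.
congr (_ * _); rewrite -big_split; apply: eq_bigr => i _ /=.
by rewrite subSn 1?ltnW // exprSr.
Qed.

(** Column operations that remove the variables one after the other leave a
    triangular matrix; row [i] retains only [x_i] on the diagonal, and its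
    power series in [u^-1] is evaluated at [u^-1 = x_i]. The factors
    [1 + beta x_t] collected on the way cancel. *)
Lemma flag_det_dominant d (q : 'I_d -> nat) :
  (d <= n)%N -> (forall i, (q i <= n)%N) ->
  \det (flag_mx (fun i => i.+1) q)
  = \prod_(i < d) \prod_(j < n | (j < q i)%N) (xnat i + bb j + be * xnat i * bb j).
Proof.
move=> hd hq.
have hn (i : 'I_d) : (i < n)%N by apply: leq_trans hd.
pose mu (i : 'I_d) : int := (q i)%:Z - i.+1%:Z + 1.
pose f (i : 'I_d) := Gpow n (i.+1%:Z - d%:Z) i.+1 (q i).
have -> : \det (flag_mx (fun i => i.+1) q) = \prod_(i < d) Dx xnat i (f i) (q i)%:Z.
  have muE i : mu i + i%:Z = (q i)%:Z by rewrite /mu; lia.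
  transitivity (\prod_(i < d) Dx xnat i (f i) (mu i + i%:Z)); last first.
    by apply: eq_bigr => i _; rewrite muE.
  rewrite -det_remove_vars // => i k; rewrite muE => hk.
  have := Dx_Gpow (Ordinal (hn i)) (i.+1%:Z - d%:Z) k (hq i).
  by rewrite Gpow_large ?mulr0 // => h; exact: h.
apply/eqP; rewrite -subr_eq0; apply/eqP.
pose D := \prod_(i < d) (1 + be * xnat i) ^+ (d - i).
have reg : forall g : A, D * g = 0 -> g = 0.
  rewrite /D; apply: (big_ind (fun z : A => forall g, z * g = 0 -> g = 0)).
  - by move=> g; rewrite mul1r.
  - by move=> y z hy hz g; rewrite -mulrA => /hy /hz.
  move=> i _; elim: (d - i)%N => [|e IH] g; first by rewrite mul1r.
  by rewrite exprS -mulrA => /reg_1p_beta_x /IH.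
apply: reg; rewrite mulrBr; apply/eqP; rewrite subr_eq0; apply/eqP.
have DE : D = _ := esym (prod_triangle (fun t => 1 + be * xnat t) d).
rewrite [in RHS]DE /D -!big_split; apply: eq_bigr => i _ /=.
have h := Dx_Gpow_top (Ordinal (hn i)) (d - i.+1) (hq i).
have e : - (d - i.+1)%N%:Z = i.+1%:Z - d%:Z :> int by have := ltn_ord i; lia.
rewrite subnSK // e in h; exact: h.
Qed.

End FlagDeterminant.

(** * Ranks, the diagram and the partition *)

Section Ranks.
Variables (n : nat) (w : 'S_n).
Local Notation r := (rank_fun w).
Local Notation wi := (w^-1)%g.

Lemma rank_Sl (i : 'I_n) q : r i.+1 q = (r i q + (w i < q))%N.
Proof.
rewrite /rank_fun (cardsD1 i) inE ltnSn /= addnC; congr (#|pred_of_set _| + _)%N.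
apply/setP => j; rewrite !inE -val_eqE /= ltnS (ltn_neqAle j) andbA.
by [].
Qed.

Lemma rank_Sr p (j : 'I_n) : r p j.+1 = (r p j + (wi j < p))%N.
Proof.
rewrite /rank_fun (cardsD1 (wi j)) inE permKV ltnSn andbT addnC.
congr (#|pred_of_set _| + _)%N; apply/setP => k; rewrite !inE ltnS.
rewrite -[k == _](inj_eq (@perm_inj _ w)) permKV.
by rewrite -val_eqE /= (ltn_neqAle (w k)) andbCA.
Qed.

Lemma rank0l q : r 0 q = 0%N.
Proof. by apply/eqP; rewrite cards_eq0; apply/eqP/setP => i; rewrite !inE. Qed.

Lemma rank0r p : r p 0 = 0%N.
Proof. by apply/eqP; rewrite cards_eq0; apply/eqP/setP => i; rewrite !inE andbF. Qed.

Lemma rank_lipl p p' q : (p <= p' <= n)%N ->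
  (r p q <= r p' q <= r p q + (p' - p))%N.
Proof.
case/andP; elim: p' => [|p' IH] hp hn; first by move: hp; rewrite leqn0 => /eqP->; lia.
move: hp; rewrite leq_eqVlt => /orP[/eqP<-|]; first lia.
rewrite ltnS => hp; have := rank_Sl (Ordinal hn) q; have := IH hp (ltnW hn).
by case: (_ < q)%N => /=; lia.
Qed.

Lemma rank_lipr p q q' : (q <= q' <= n)%N ->
  (r p q <= r p q' <= r p q + (q' - q))%N.
Proof.
case/andP; elim: q' => [|q' IH] hq hn; first by move: hq; rewrite leqn0 => /eqP->; lia.
move: hq; rewrite leq_eqVlt => /orP[/eqP<-|]; first lia.
rewrite ltnS => hq; have := rank_Sr p (Ordinal hn); have := IH hq (ltnW hn).
by case: (_ < p)%N => /=; lia.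
Qed.

Lemma rank_lel p q : (p <= n)%N -> (r p q <= p)%N.
Proof. by move=> hp; have := @rank_lipl 0 p q; rewrite rank0l; lia. Qed.

Lemma rank_ler p q : (q <= n)%N -> (r p q <= q)%N.
Proof. by move=> hq; have := @rank_lipr p 0 q; rewrite rank0r; lia. Qed.

Lemma diagramE i j : ((i, j) \in diagram w) = (j < w i)%N && (i < wi j)%N.
Proof. by rewrite inE. Qed.

Lemma rank_diag (i j : 'I_n) :
  r i.+1 j.+1 = (r i j + (wi j < i) + (w i <= j))%N.
Proof. by rewrite rank_Sl rank_Sr. Qed.

Lemma rank_diag_box (i j : 'I_n) : (i, j) \in diagram w -> r i.+1 j.+1 = r i j.
Proof. by rewrite diagramE rank_diag => /andP[h1 h2]; rewrite (leqNgt (w i)) h1 (ltnNge (wi j)) (ltnW h2) !addn0. Qed.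

Lemma rank_diag_nbox (i j : 'I_n) : (i, j) \notin diagram w -> (r i j < r i.+1 j.+1)%N.
Proof.
rewrite diagramE rank_diag; have [h|h] := leqP (w i) j; first by move=> _; rewrite addn1 ltnS leq_addr.
rewrite /= addn0 -leqNgt leq_eqVlt => /orP[/eqP/val_inj e|->]; last by rewrite addn1.
by move: h; rewrite -{1}e permKV ltnn.
Qed.

(** A discrete intermediate value theorem: along a diagonal [p - r(p,q)]
    increases only at boxes of the diagram, and then by one. *)
Lemma diag_box p q i : (p <= n)%N -> (q <= n)%N -> (0 < i)%N ->
  (r p q + i <= p)%N -> (p < i + q)%N ->
  exists a b : 'I_n, [/\ (a, b) \in diagram w, (a < p)%N, (b + p = a + q)%N
    & (r a.+1 b.+1 + i = a.+1)%N].
Proof.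
elim: p q => [|p IH] [|q] hp hq i0 hr hi; try by exfalso; lia.
have {}IH : (r p q + i <= p)%N -> exists a b : 'I_n, [/\ (a, b) \in diagram w,
    (a < p.+1)%N, (b + p.+1 = a + q.+1)%N & (r a.+1 b.+1 + i = a.+1)%N].
  move=> h; have [|||a [b [hD ap hd e]]] := IH q _ _ i0 h; [lia..|].
  by exists a, b; split => //; lia.
pose a := Ordinal hp; pose b := Ordinal hq.
have [hD|/rank_diag_nbox /= h] := boolP ((a, b) \in diagram w); last by apply: IH; lia.
have /= e := rank_diag_box hD.
have [le|gt] := leqP (r p q + i) p; first exact: IH.
by exists a, b; split => //=; lia.
Qed.

(** A box that is not essential has a neighbour in the diagram, below it or to
    its right, and the rank there is the same. *)
Lemma box_essential (a b : 'I_n) : (a, b) \in diagram w ->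
  exists a' b' : 'I_n, [/\ (a <= a')%N, (b <= b')%N,
    r a'.+1 b'.+1 = r a.+1 b.+1 & essential w a'.+1 b'.+1].
Proof.
have [m] := ubnP (n - a + (n - b)); elim: m a b => // m IH a b hm hD.
have := hD; rewrite diagramE => /andP[hb ha].
have an : (a.+1 < n)%N by apply: leq_ltn_trans (ltn_ord (wi b)).
have bn : (b.+1 < n)%N by apply: leq_ltn_trans (ltn_ord (w a)).
pose a1 := Ordinal an; pose b1 := Ordinal bn.
have [h|h] := ltnP b (w a1).
  have D1 : (a1, b) \in diagram w.
    rewrite diagramE h ltn_neqAle ha andbT; apply/eqP => /val_inj e.
    by move: h; rewrite e permKV ltnn.
  have [|a' [b' [h1 h2 h3 h4]]] := IH _ _ _ D1; first by move: hm => /=; lia.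
  exists a', b'; split => //; first exact: ltnW.
  by rewrite h3 (rank_Sl a1) /= ltnS leqNgt h addn0.
have [h'|h'] := ltnP a (wi b1).
  have D1 : (a, b1) \in diagram w.
    rewrite diagramE h' andbT ltn_neqAle hb andbT; apply/eqP => /val_inj e.
    by move: h'; rewrite e permK ltnn.
  have [|a' [b' [h1 h2 h3 h4]]] := IH _ _ _ D1; first by move: hm => /=; lia.
  exists a', b'; split => //; first exact: ltnW.
  by rewrite h3 (rank_Sr _ b1) /= ltnS leqNgt h' addn0.
by exists a, b; split => //; exists a, a1, b, b1.
Qed.

End Ranks.

Section FlagBounds.
Variables (n : nat) (w : 'S_n) (d : nat) (p q : 'I_d -> nat).
Hypothesis fl : flagging_set w p q.
Local Notation r := (rank_fun w).

Lemma flag_le i : (p i <= n)%N /\ (q i <= n)%N.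
Proof. by case: fl => /(_ i) [/andP[_ h] /andP[_ h']]. Qed.

Lemma flag_rank i : (r (p i) (q i) + i.+1 = p i)%N.
Proof. by case: fl => _ _ _ /(_ i); lia. Qed.

Lemma flag_mono (i j : 'I_d) : (i <= j)%N -> (p i <= p j)%N /\ (q j <= q i)%N.
Proof. by case: fl => _ /(_ i j). Qed.

Lemma flag_box (a b : 'I_n) : (a, b) \in diagram w ->
  exists m : 'I_d, [/\ (a < p m)%N, (b < q m)%N, r (p m) (q m) = r a.+1 b.+1,
    essential w (p m) (q m) & (r a.+1 b.+1 + m.+1 = p m)%N].
Proof.
move=> /box_essential [a' [b' [ha hb hr he]]].
have [m [pm qm]] : exists m, p m = a'.+1 /\ q m = b'.+1.
  by case: fl => _ _ + _; apply.
exists m; rewrite pm qm hr; split => //.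
by have := flag_rank m; rewrite pm qm hr.
Qed.

(** The part [q_i - p_i + i] is the largest that the ranks allow: a violation
    produces a box of the diagram, then an essential box of larger index, and
    between them the rank would have to grow faster than it can. *)
Lemma flag_upper a b (i : 'I_d) : (a <= n)%N -> (b <= n)%N ->
  (r a b + i.+1 <= a)%N -> (b + p i <= q i + a)%N.
Proof.
move=> han hbn hr; rewrite leqNgt; apply/negP => hlt.
have [hpi hqi] := flag_le i; have fi := flag_rank i.
have := rank_ler w (p i) hqi => ri.
have [|a0 [b0 [hD ha0 hd hr0]]] := diag_box han hbn (ltn0Sn i) hr; first lia.
have [m [ham hbm hrm _ hm]] := flag_box hD.
have [hpm hqm] := flag_le m.
have [pim qim] : (p i <= p m)%N /\ (q m <= q i)%N by apply: flag_mono; lia.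
have := @rank_lipl _ w a0.+1 (p i) b0.+1.
have := @rank_lipl _ w (p i) (p m) b0.+1.
have := @rank_lipr _ w (p m) b0.+1 (q m).
have := @rank_lipr _ w (p i) b0.+1 (q i).
by rewrite hrm; lia.
Qed.

End FlagBounds.

Section Shape.
Variables (n : nat) (w : 'S_n) (lam : seq nat).
Local Notation r := (rank_fun w).
Local Notation wi := (w^-1)%g.
Local Notation diag A B := [set ij in diagram w | ij.2%:Z - ij.1%:Z == B%:Z - A%:Z].
Local Notation youngd A B := (count (fun ij => ij.2%:Z - ij.1%:Z == B%:Z - A%:Z) (young lam)).

(** By the intermediate value theorem each value of [p - r(p,q)] is taken at a box
    of its own. *)
Lemma diag_card_ge p q i : (p <= n)%N -> (q <= n)%N -> (0 < i)%N ->
  (r p q + i <= p)%N -> (p < i + q)%N -> (i - (p - q) <= #|diag p q|)%N.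
Proof.
move=> hp hq i0 hr hi; pose phi (ab : 'I_n * 'I_n) := (ab.1.+1 - r ab.1.+1 ab.2.+1)%N.
rewrite cardE -(size_map phi) -[X in (X <= _)%N](size_iota (p - q).+1).
apply: uniq_leq_size; first exact: iota_uniq.
move=> j; rewrite mem_iota => /andP[j1 j2].
have [|||a [b [hD _ hd hj]]] := @diag_box _ w p q j hp hq; [lia..|].
apply/mapP; exists (a, b); last by rewrite /phi /=; lia.
by rewrite mem_enum finset.in_set hD /=; lia.
Qed.

(** A position where the rank grows by two and a later box of the diagram on
    the same diagonal would exhibit the pattern 2143. So between two boxes of a
    diagonal [p - r(p,q)] never decreases. *)
Lemma diag_rank_lt (a b a' b' : 'I_n) : vexillary w ->
  (a, b) \in diagram w -> (a', b') \in diagram w -> (a < a')%N -> (b + a' = a + b')%N ->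
  (r a'.+1 b'.+1 + a < r a.+1 b.+1 + a')%N.
Proof.
move=> vex hD hD' aa' hd.
suff h s : (a + s < a')%N -> (r (a + s).+1 (b + s).+1 <= r a.+1 b.+1 + s)%N.
  have := h (a' - a.+1)%N; rewrite (rank_diag_box hD').
  have -> : ((a + (a' - a.+1)).+1 = a')%N by lia.
  have -> : ((b + (a' - a.+1)).+1 = b')%N by lia.
  by lia.
elim: s => [|s IH] hs; first by rewrite !addn0.
have hi : (a + s.+1 < n)%N by have := ltn_ord a'; lia.
have hj : (b + s.+1 < n)%N by have := ltn_ord b'; lia.
pose i := Ordinal hi; pose j := Ordinal hj.
have IH' : (r i j <= r a.+1 b.+1 + s)%N by rewrite /= !addnS; apply: IH; lia.
rewrite -[(a + s.+1)%N]/(i : nat) -[(b + s.+1)%N]/(j : nat) rank_diag.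
suff : ~~ ((wi j < i)%N && (w i <= j)%N).
  by move: IH'; case: (wi j < i)%N; case: (w i <= j)%N => //=; lia.
apply/negP => /andP[h1 h2]; have {}h2 : (w i < j)%N.
  rewrite ltn_neqAle h2 andbT; apply/eqP => /val_inj e.
  by move: h1; rewrite -e permK ltnn.
apply: vex; exists (wi j), i, a', (wi b').
move: hD'; rewrite diagramE => /andP[h3 h4].
by rewrite !permKV h1; split => //=; lia.
Qed.

Lemma diag_card_le A B i : vexillary w ->
  (forall a b : 'I_n, (a, b) \in diagram w -> (b + A = a + B)%N ->
     (a.+1 < r a.+1 b.+1 + i)%N) ->
  (#|diag A B| <= i.-1 - (A - B))%N.
Proof.
move=> vex h; pose phi (ab : 'I_n * 'I_n) := (ab.1.+1 - r ab.1.+1 ab.2.+1)%N.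
have mem_diag ab : (ab \in diag A B) = ((ab \in diagram w) && (ab.2 + A == ab.1 + B)%N).
  by rewrite finset.in_set; congr (_ && _); lia.
have rk (a b : 'I_n) : (a, b) \in diagram w -> (r a.+1 b.+1 <= a)%N /\ (r a.+1 b.+1 <= b)%N.
  move=> /rank_diag_box->; split; first by apply/rank_lel/ltnW.
  by apply/rank_ler/ltnW.
rewrite cardE -(size_map phi) -[X in (_ <= X)%N](size_iota (A - B).+1).
apply: uniq_leq_size; last first.
  move=> x /mapP[[a b]]; rewrite mem_enum mem_diag /= => /andP[hD /eqP hd] ->.
  by rewrite mem_iota /phi /=; have [] := rk _ _ hD; have := h _ _ hD hd; lia.
rewrite map_inj_in_uniq ?enum_uniq // => -[a b] [a' b'].
rewrite !mem_enum !mem_diag /= => /andP[hD /eqP hd] /andP[hD' /eqP hd'].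
rewrite /phi /=; have [k1 k2] := rk _ _ hD; have [k3 k4] := rk _ _ hD'.
have [lt|gt|e] := ltngtP a a'.
- by have := diag_rank_lt vex hD hD' lt; lia.
- by have := diag_rank_lt vex hD' hD gt; lia.
move=> _; congr (_, _); apply: val_inj => //=; lia.
Qed.

Lemma mem_young i j : ((i, j) \in young lam) = (j < nth 0 lam i)%N.
Proof.
apply/allpairsPdep/idP => [[a [b [_ hb [-> ->]]]]|h].
  by move: hb; rewrite mem_iota.
exists i, j; split; rewrite ?mem_iota //=.
by rewrite add0n ltnNge; apply/negP => hs; rewrite nth_default in h.
Qed.

Lemma young_uniq : uniq (young lam).
Proof.
apply: allpairs_uniq_dep; rewrite ?iota_uniq //; first by move=> ? _; apply: iota_uniq.
by move=> [a b] [a' b'] _ _ /= [-> ->].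
Qed.

Lemma part_nth i j : is_partition lam -> (i <= j)%N -> (nth 0 lam j <= nth 0 lam i)%N.
Proof.
move=> [srt _] ij; have [sj|sj] := leqP (size lam) j; first by rewrite (nth_default _ sj).
have tr : transitive geq by move=> x y z xy yz; apply: leq_trans yz xy.
by apply: (sorted_leq_nth tr leqnn) => //; apply: leq_ltn_trans sj.
Qed.

Lemma young_ge A B i : is_partition lam -> (A <= i + B)%N ->
  (i + B < nth 0 lam i + A)%N -> (i.+1 - (A - B) <= youngd A B)%N.
Proof.
move=> part hA hi.
pose s := [seq (j, j + B - A)%N | j <- iota (A - B) (i.+1 - (A - B))].
have -> : (i.+1 - (A - B) = size s)%N by rewrite size_map size_iota.
rewrite -size_filter; apply: uniq_leq_size.
  by rewrite map_inj_uniq ?iota_uniq // => j j' [].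
move=> x /mapP[j]; rewrite mem_iota => /andP[h1 h2] ->.
rewrite mem_filter mem_young /=; apply/andP; split; first lia.
by have := @part_nth j i part; lia.
Qed.

Lemma young_le A B i : is_partition lam -> (A <= i + B)%N ->
  (nth 0 lam i + A <= i + B)%N -> (youngd A B <= i - (A - B))%N.
Proof.
move=> part hA hi; rewrite -size_filter -(size_map fst).
rewrite -[X in (_ <= X)%N](size_iota (A - B)); apply: uniq_leq_size; last first.
  move=> x /mapP[[a b]]; rewrite mem_filter mem_young /= => /andP[/eqP hk hb] ->.
  rewrite mem_iota; apply/andP; split; first lia.
  have [ia|] := leqP i a; last by lia.
  by have := part_nth part ia; lia.
rewrite map_inj_in_uniq ?filter_uniq ?young_uniq // => -[a b] [a' b'].
by rewrite !mem_filter /= => /andP[/eqP h _] /andP[/eqP h' _] e; congr (_, _) => //; lia.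
Qed.

(** Whether the box [(i, j)] belongs to the partition is seen from the number of
    boxes on its diagonal, which for the diagram of [w] is governed by the largest
    value of [p - r(p,q)] there. The point [(p_i, q_i)] attains the value [i] on
    its own diagonal, and by [flag_upper] no point of the next one does. *)
Lemma shape_flag d (p q : 'I_d -> nat) (i : 'I_d) : vexillary w -> shape_of w lam ->
  flagging_set w p q -> (nth 0 lam i + r (p i) (q i) = q i)%N.
Proof.
move=> vex [part shp] fl; have [hp hq] := flag_le fl i; have fi := flag_rank fl i.
have hr := rank_ler w (p i) hq.
pose l := (q i - r (p i) (q i))%N.
suff : nth 0%N lam i = l by rewrite /l; lia.
have [lt|gt|//] := ltngtP (nth 0%N lam i) l.
  have := diag_card_ge (i := i.+1) hp hq; rewrite -shp.
  have := @young_le (p i) (q i) i part; rewrite /l in lt; lia.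
have yg := @young_ge (p i) (q i).+1 i part; rewrite shp in yg.
have dl : (#|diag (p i) (q i).+1| <= i.+1.-1 - (p i - (q i).+1))%N.
  apply: diag_card_le => // a b hD hd; rewrite ltnNge; apply/negP => hle.
  by have := flag_upper fl (i := i) (ltn_ord a) (ltn_ord b) hle; lia.
by rewrite /l in gt; have {}yg := leq_trans (yg _ _) dl; lia.
Qed.

End Shape.

(** * Grothendieck polynomials of dominant permutations *)

Section Dominant.
Variable n : nat.
Implicit Types w : 'S_n.
Local Notation x := (@xvar n).
Local Notation b := (@bvar n).
Local Notation G := (@double_grothendieck n).

Lemma groth_pi w (a a' : 'I_n) : a' = a.+1 :> nat -> (w a < w a')%N ->
  (x a - x a') * G w = (1 + beta * x a') * G (mul_s w a a')
    - (1 + beta * x a) * s_act a a' (G (mul_s w a a')).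
Proof.
move=> aa' wa; have [_ h] := double_grothendieckP n.
have /(_ _) := h (mul_s w a a') a a' aa'.
by rewrite mul_sK (length_ascent aa' wa) => -> //; apply: pi_opP.
Qed.

Definition order_ideal (D : {set 'I_n * 'I_n}) : Prop :=
  forall i j i' j' : 'I_n, (i, j) \in D -> (i' <= i)%N -> (j' <= j)%N -> (i', j') \in D.

Lemma mul_s_invE w (a a' j : 'I_n) : ((mul_s w a a')^-1)%g j = tperm a a' ((w^-1)%g j).
Proof. by rewrite /mul_s invMg tpermV permM. Qed.

Lemma lt_tperm (a a' i k : 'I_n) : a' = a.+1 :> nat -> i != a ->
  (i < tperm a a' k)%N = (i < k)%N.
Proof.
by rewrite -val_eqE /= => aa' ia; case: tpermP => [->|->|//]; rewrite ?aa'; lia.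
Qed.

(** A permutation without ascents is decreasing, hence the longest one. *)
Lemma first_ascent w : w <> longest n ->
  exists a a' : 'I_n, [/\ a' = a.+1 :> nat, (w a < w a')%N
    & forall i j : 'I_n, (i < j <= a)%N -> (w j < w i)%N].
Proof.
have decr (N : nat) : (forall a a' : 'I_n, a' = a.+1 :> nat -> (a' < N)%N -> (w a' < w a)%N) ->
    forall i j : 'I_n, (i < j < N)%N -> (w j < w i)%N.
  move=> hN i; suff h m : forall j : 'I_n, j = m :> nat -> (i < j < N)%N -> (w j < w i)%N.
    by move=> j; apply: (h j).
  elim: m => [|m IH] j ej ij; first by move: ij; rewrite ej.
  have mn : (m < n)%N by apply: leq_trans (ltn_ord j); rewrite ej.
  have := hN (Ordinal mn) j ej; have := IH (Ordinal mn) erefl => /=.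
  have [im|im] := ltnP i m; first by move=> h1 h2; apply: ltn_trans (h2 _) (h1 _); lia.
  have -> : Ordinal mn = i by apply: val_inj => /=; lia.
  by move=> _ -> //; lia.
move=> nw.
pose asc (m : nat) := [exists a : 'I_n, [exists a' : 'I_n, [&& a == m :> nat, a' == m.+1 :> nat & (w a < w a')%N]]].
have [/existsP ex|] := boolP [exists m : 'I_n, asc m]; last first.
  move=> /existsPn nex; case: nw.
  have hd : forall i j : 'I_n, (i < j < n)%N -> (w j < w i)%N.
    apply: decr => a a' aa' _; rewrite ltnNge; apply/negP => le.
    have /negP[] := nex a; apply/existsP; exists a; apply/existsP; exists a'.
    rewrite eqxx aa' eqxx /= ltn_neqAle le andbT; apply/eqP => /val_inj/perm_inj e.
    by move: aa'; rewrite e; lia.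
  have up i (hi : (i < n)%N) : (w (Ordinal hi) + i.+1 <= n)%N.
    elim: i hi => [|i IH] hi; first by rewrite addn1.
    have := hd (Ordinal (ltnW hi)) (Ordinal hi); have := IH (ltnW hi).
    by rewrite /= hi ltnSn; lia.
  have dn m i (hi : (i < n)%N) : (i.+1 + m = n)%N -> (m <= w (Ordinal hi))%N.
    elim: m i hi => [|m IH] i hi e //.
    have hi1 : (i.+1 < n)%N by lia.
    have := hd (Ordinal hi) (Ordinal hi1); have := IH _ hi1.
    by rewrite /= hi1 ltnSn addSnnS; move=> h1 h2; have := h1 e; have := h2 isT; lia.
  apply/permP => -[i hi]; apply: val_inj; rewrite permE /=.
  by have := up i hi; have := dn (n - i.+1)%N i hi; lia.
have exm : exists m, asc m by case: ex => m; exists m.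
case: (ex_minnP exm) => m /existsP[a /existsP[a' /and3P[/eqP am /eqP am' wa]]] mmin.
exists a, a'; split; [by rewrite am am' | by [] |].
move=> i j ij; apply: (decr m.+1); last by rewrite ltnS -am.
move=> c c' cc' hc; rewrite ltnNge; apply/negP => le.
suff /mmin : asc c by lia.
apply/existsP; exists c; apply/existsP; exists c'; rewrite eqxx cc' eqxx /=.
rewrite ltn_neqAle le andbT; apply/eqP => /val_inj/perm_inj e.
by move: cc'; rewrite e; lia.
Qed.

Section AscentStep.
Variables (w : 'S_n) (a a' : 'I_n).
Hypotheses (aa' : a' = a.+1 :> nat) (wa : (w a < w a')%N)
  (decr : forall i j : 'I_n, (i < j <= a)%N -> (w j < w i)%N)
  (ideal : order_ideal (diagram w)).
Local Notation wi := (w^-1)%g.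
Local Notation v := (mul_s w a a').

Let nota' (j : 'I_n) : (j < w a')%N -> wi j != a'.
Proof. by move=> h; apply: contraTneq h => <-; rewrite permKV ltnn. Qed.

Lemma ascent_rows (j : 'I_n) : ((a, j) \in diagram w) = ((a', j) \in diagram w).
Proof.
apply/idP/idP => h; last by apply: (ideal h) => //; rewrite aa'.
move: h; rewrite !diagramE => /andP[h1 h2]; have h3 := ltn_trans h1 wa.
by rewrite h3 ltn_neqAle aa' h2 andbT -aa' eq_sym; apply: nota'.
Qed.

Lemma ascent_diagram : diagram v = (a, w a) |: diagram w.
Proof.
apply/setP => -[i j]; rewrite in_setU1 xpair_eqE !diagramE mul_sE mul_s_invE.
have [->|ia] := eqVneq i a; rewrite /=; last first.
  rewrite lt_tperm //; have [->|ia'] := eqVneq i a'; last by rewrite tpermD // eq_sym.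
  rewrite tpermR; have := ascent_rows j; rewrite !diagramE => h.
  apply/andP/andP => -[h1 h2]; split => //; first exact: ltn_trans wa.
  by move: h; rewrite h1 h2 => /andP[].
rewrite tpermL; apply/andP/orP => [[h1]|[/eqP->|/andP[h1 h2]]].
- case: tpermP => [e _|e|_ _ h2]; first by left; rewrite -e permKV.
    by rewrite ltnn.
  have h : (a, j) \in diagram w by rewrite ascent_rows diagramE h1 ltn_neqAle aa' h2 andbT -aa' eq_sym nota'.
  by right; move: h; rewrite diagramE.
- by rewrite permK tpermL aa' ltnSn.
split; first exact: ltn_trans wa.
rewrite tpermD //; first by apply: contraTneq h2 => <-; rewrite ltnn.
by rewrite eq_sym nota' // (ltn_trans h1).
Qed.

Lemma ascent_ideal : order_ideal (diagram v).
Proof.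
move=> i j i' j'; rewrite ascent_diagram !in_setU1 => /orP[/eqP[-> ->]|h] hi hj; last first.
  by rewrite (ideal h) // orbT.
have big (k : 'I_n) : (k <= a)%N -> (w a <= w k)%N.
  rewrite leq_eqVlt => /orP[/eqP/val_inj->//|ka]; rewrite ltnW // decr // ka leqnn.
  by [].
have [->|ne] := eqVneq (i', j') (a, w a); first by [].
rewrite /= diagramE; move: hi; rewrite leq_eqVlt => /orP[/eqP/val_inj ei|hi].
  subst i'; have lt : (j' < w a)%N.
    rewrite ltn_neqAle hj andbT; apply: contra ne => /eqP/val_inj->; exact: eqxx.
  rewrite lt /= ltnNge; apply/negP => /big; rewrite permKV leqNgt lt //.
rewrite (leq_ltn_trans hj) /=; last by apply: decr; rewrite hi leqnn.
rewrite (leq_trans hi) // leqNgt; apply/negP => h.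
have := @decr (wi j') a; rewrite h leqnn permKV => /(_ isT).
by rewrite ltnNge hj.
Qed.

End AscentStep.

(** Descending induction on the length. At the first ascent [a] the rows [a] and
    [a+1] of the diagram agree, and [w s_a] has the additional box
    [(a, w(a))]. The rest of the product is symmetric in [x_a] and [x_(a+1)],
    and the divided difference turns the factor of that box into [1]. *)
Lemma groth_dominant w : order_ideal (diagram w) ->
  G w = \prod_(ij in diagram w) (x ij.1 + b ij.2 + beta * x ij.1 * b ij.2).
Proof.
pose F (ij : 'I_n * 'I_n) := x ij.1 + b ij.2 + beta * x ij.1 * b ij.2.
have [m] := ubnP (n * n - perm_length w); elim: m w => // m IH w hm ideal.
have [->|/eqP nw] := eqVneq w (longest n).
  have [-> _] := double_grothendieckP n.
  rewrite pair_big_dep /=; apply: eq_bigl => -[i j] /=.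
  have e k : longest n k = (n - k.+1)%N :> nat by rewrite permE.
  have -> : (i, j) \in diagram (longest n) = (j < longest n i)%N.
    rewrite diagramE; apply: andb_idr => h.
    have : ((longest n)^-1)%g j = rev_ord j.
      by apply: (@perm_inj _ (longest n)); rewrite permKV permE rev_ordK.
    by move=> ->; move: h; rewrite e /=; lia.
  by rewrite e; lia.
have [a [a' [aa' wa decr]]] := first_ascent nw.
have lv := length_ascent aa' wa; have lle := perm_length_le (mul_s w a a').
have hv := IH (mul_s w a a') _ (ascent_ideal aa' wa decr ideal).
have h := groth_pi aa' wa; rewrite hv in h; last by lia.
rewrite (ascent_diagram aa' wa ideal) in h.
rewrite big_setU1 in h; last by rewrite diagramE ltnn.
set P := \prod_(ij in diagram w) _ in h *.
have sP : s_act a a' P = P.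
  pose f (ij : 'I_n * 'I_n) := (tperm a a' ij.1, ij.2).
  have finv : involutive f by move=> [i j]; rewrite /f /= tpermK.
  rewrite /P rmorph_prod [RHS](reindex_inj (inv_inj finv)) /=.
  apply: eq_big => [[i j]|[i j] _]; rewrite /f /=.
    by case: tpermP => [->|->|//]; rewrite (ascent_rows aa' wa ideal).
  by rewrite !rmorphD !rmorphM /= !s_act_x s_act_beta s_act_b.
have na : a != a' by rewrite -val_eqE /= aa'; lia.
apply: (mulfI (x_sub_neq0 na)); rewrite h rmorphM /= sP !rmorphD !rmorphM /= !s_act_x s_act_beta s_act_b.
rewrite tpermL; set y := b _; ring.
Qed.

End Dominant.

(** * Moving one point of a flagging set *)

Section FlagStep.
Variable n : nat.

Lemma rank_mul_s (w : 'S_n) (a a' : 'I_n) p q : a' = a.+1 :> nat -> p <> a.+1 ->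
  rank_fun (mul_s w a a') p q = rank_fun w p q.
Proof.
move=> aa' hp; rewrite /rank_fun -(card_imset _ (@perm_inj _ (tperm a a'))).
congr #|pred_of_set _|; apply/setP => i; rewrite -[in LHS](tpermK a a' i).
rewrite (mem_imset _ _ (@perm_inj _ _)) !inE mul_sE tpermK; congr (_ && _).
by case: tpermP => [->|->|//]; rewrite aa'; lia.
Qed.

Variables (w : 'S_n) (d : nat) (p q : 'I_d -> nat).
Hypothesis fl : flagging_set w p q.
Local Notation r := (rank_fun w).
Local Notation wi := (w^-1)%g.

Section FirstShift.
Variable k : 'I_d.
Hypotheses (below : forall i : 'I_d, (i < k)%N -> p i = i.+1) (pk : p k <> k.+1).

(** The rows before [k] have rank [0], so the values at the first [k] positions
    all exceed [q_(k-1) >= q_k]. *)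
Lemma rank_first_rows : r k (q k) = 0%N.
Proof.
case: (posnP k) => [->|k0]; first exact: rank0l.
have kd : (k.-1 < d)%N by apply: leq_ltn_trans (ltn_ord k); apply: leq_pred.
pose i := Ordinal kd; have ik : (i < k)%N by rewrite /= prednK.
have := flag_rank fl i; have pi := below ik; rewrite pi /= prednK // => e.
have [_ hq] := flag_mono fl (ltnW ik); have [_ hqi] := flag_le fl i.
by have := @rank_lipr _ w k (q k) (q i); lia.
Qed.

(** By maximality of [q_k - p_k] the
    [k]-th value above [q_k] stands exactly at position [p_k], so that exchanging
    it with its left neighbour moves [(p_k, q_k)] one step up. *)
Lemma flag_descent : exists a a' : 'I_n,
  [/\ a' = a.+1 :> nat, p k = a.+2, (k <= a)%N, (w a < q k <= w a')%N
    & r a (q k) = (a - k)%N].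
Proof.
have [hp hq] := flag_le fl k; have hk := flag_rank fl k.
have an : ((p k).-2 < n)%N by lia.
have an' : ((p k).-1 < n)%N by lia.
pose a := Ordinal an; pose a' := Ordinal an'.
have aa' : a' = a.+1 :> nat by rewrite /=; lia.
have pa : p k = a.+2 by rewrite /=; lia.
have ka : (k <= a)%N by rewrite /=; lia.
clearbody a a'.
have hb : (a' - k <= r a' (q k))%N.
  rewrite leqNgt; apply/negP => lt.
  have := flag_upper fl (a := a') (b := q k) (i := k) (ltnW (ltn_ord _)) hq.
  by rewrite pa; lia.
have e1 := rank_Sl w a' (q k); have e2 := rank_Sl w a (q k).
have := @rank_lipl _ w k a (q k); rewrite rank_first_rows => e3.
rewrite aa' -pa in e1; rewrite aa' in hb.
have ha := ltn_ord a.
exists a, a'; split => //; last by lia.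
case: (ltnP (w a) (q k)) e2 => h1 e2; case: (ltnP (w a') (q k)) e1 => h2 e1 //=; lia.
Qed.

Definition flag_up (i : 'I_d) : nat := if i == k then (p k).-1 else p i.

(** Outside row [a] an essential box of [w s_a] is one of [w], and not the moved
    one. In row [a] the only candidate is [(a, q_k)]. *)
Lemma flag_up_essential (a a' i i' j j' : 'I_n) :
  a' = a.+1 :> nat -> p k = a.+2 -> (k <= a)%N -> (w a < q k)%N -> (q k <= w a')%N ->
  i' = i.+1 :> nat -> j' = j.+1 :> nat ->
  (j < mul_s w a a' i)%N -> (mul_s w a a' i' <= j)%N ->
  (i < (mul_s w a a')^-1%g j)%N -> ((mul_s w a a')^-1%g j' <= i)%N ->
  exists m, flag_up m = i.+1 /\ q m = j.+1.
Proof.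
move=> aa' pa ka wa wa' ii' jj'; rewrite !mul_sE !mul_s_invE => h1 h2 h3 h4.
have [ia|ia] := eqVneq i a.
  have ia' : i' = a' by apply: val_inj; rewrite /= ii' ia aa'.
  subst i i'; rewrite tpermL in h1; rewrite tpermR in h2.
  suff e : q k = j.+1 by exists k; rewrite /flag_up eqxx pa.
  have na' : wi j != a' by apply: contraTneq h1 => <-; rewrite permKV ltnn.
  have [lt|gt|//] := ltngtP j.+1 (q k); last first.
    (* the essential box reached from [(a', j)] would have index below [k], and
       yet lie in row [p_k] or further down *)
    have na : wi j != a by apply: contraTneq gt => e; move: wa; rewrite -e permKV; lia.
    rewrite tpermD 1?eq_sym // in h3.
    have hD : (a', j) \in diagram w.
      by rewrite diagramE h1 ltn_neqAle eq_sym na' aa' h3.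
    have [m [hm hq _ _ hr]] := flag_box fl hD.
    have mk : (m < k)%N.
      by rewrite ltnNge; apply/negP => /(flag_mono fl)[_]; lia.
    by have := below mk; lia.
  (* the value [j'] stands before [a], so the essential box reached from its row
     lies in column [j]; it has index above [k], hence lies below row [a], whose
     value [w a <= j] has increased the rank *)
  have wj' : wi j' != a' by apply: contraTneq wa' => <-; rewrite permKV; lia.
  have lta : (wi j' < a)%N.
    move: h4; case: tpermP => [_|e|/eqP]; [lia | by rewrite e eqxx in wj' |].
    by rewrite -val_eqE /=; lia.
  have hD : (wi j', j) \in diagram w.
    rewrite diagramE permKV jj' ltnSn /=.
    by move: h3; case: tpermP => [->|_|_ _]; lia.
  have [m [hm hq hr _ _]] := flag_box fl hD; have [hpm hqm] := flag_le fl m.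
  have e := rank_Sr w (wi j').+1 j'; rewrite ltnSn jj' in e.
  have eq : q m = j.+1.
    have [lt2|] := ltnP j.+1 (q m); last lia.
    have := @rank_lipl _ w (wi j').+1 (p m) (q m).
    by have := @rank_lipr _ w (wi j').+1 j.+2 (q m); lia.
  have km : (k < m)%N by rewrite ltnNge; apply/negP => /(flag_mono fl)[_]; lia.
  have [pkm _] := flag_mono fl (ltnW km).
  have := rank_Sl w a j.+1; rewrite ltnS h2 -eq.
  have := @rank_lipl _ w (wi j').+1 a (q m); have := @rank_lipl _ w a.+1 (p m) (q m).
  by rewrite eq; rewrite eq in hr; lia.
rewrite lt_tperm // in h3; rewrite leqNgt lt_tperm // -leqNgt in h4.
have fin : (j < w i)%N -> (w i' <= j)%N -> (i = a' -> q k <> j.+1) ->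
    exists m, flag_up m = i.+1 /\ q m = j.+1.
  move=> e1 e2 ne; have [m [pm qm]] : exists m, p m = i.+1 /\ q m = j.+1.
    by case: fl => _ _ + _; apply; exists i, i', j, j'.
  exists m; rewrite /flag_up; case: eqP => [mk|//]; subst m.
  by case: ne => //; apply: val_inj => /=; lia.
have [ia'|ia'] := eqVneq i a'.
  subst i; rewrite tpermR in h1.
  have wai : w (tperm a a' i') = w i' by rewrite tpermD // -val_eqE /=; lia.
  by rewrite wai in h2; apply: fin => //; lia.
have wi1 : w (tperm a a' i) = w i by rewrite tpermD // eq_sym.
rewrite wi1 in h1; apply: fin => // [|e]; last by rewrite e eqxx in ia'.
have [e|ne] := eqVneq i' a.
  by move: h2; rewrite e tpermL; lia.
rewrite tpermD // 1?eq_sym // in h2; rewrite -val_eqE /=.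
by move: ia; rewrite -val_eqE /=; lia.
Qed.

Lemma flag_step : exists a a' : 'I_n,
  [/\ a' = a.+1 :> nat, (w a < w a')%N, p k = a.+2, forall i, i != k -> p i <> a.+1
    & flagging_set (mul_s w a a') flag_up q].
Proof.
have [a [a' [aa' pa ka /andP[wa wa'] ra]]] := flag_descent.
have oth i : i != k -> p i <> a.+1.
  rewrite -val_eqE /= => ik; have [lt|gt|e] := ltngtP i k.
  - by rewrite below //; lia.
  - by have [h _] := flag_mono fl (ltnW gt); lia.
  by rewrite e eqxx in ik.
have ww := leq_trans wa wa'.
exists a, a'; split => //; rewrite /flag_up; split.
- move=> i; have [h h'] : (1 <= p i <= n)%N /\ (1 <= q i <= n)%N by case: fl.
  by split => //; case: eqP => // _; have := ltn_ord a; lia.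
- move=> i j ij; have [h h'] := flag_mono fl ij; split => //.
  have [ik|ik] := eqVneq i k; have [jk|jk] := eqVneq j k => //.
  + by subst i; apply: leq_trans (leq_pred _) h.
  + have lt : (i < k)%N by rewrite ltn_neqAle val_eqE ik -jk.
    by rewrite below // pa; lia.
- move=> _ _ [i [i' [j [j' [-> -> ii' jj' [h1 h2 h3 h4]]]]]].
  exact: (flag_up_essential aa' pa ka wa wa' ii' jj').
move=> i; have [ik|ik] := eqVneq i k.
  subst i; rewrite pa /= rank_Sl mul_sE tpermL rank_mul_s //.
  by rewrite ra ltnNge wa' /=; lia.
by rewrite rank_mul_s //; [have := flag_rank fl i; lia | exact: oth].
Qed.

End FirstShift.
End FlagStep.

(** * The determinant formula *)

Section FlagFormula.
Variable n : nat.
Local Notation A := (dseries n).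
Local Notation toA := (@mfps_of_mpoly (n + n) Zbeta).
Local Notation be := (toA beta).
Local Notation xx i := (toA (xvar i)).
Local Notation bb j := (toA (bvar j)).

(** The ranks [r(i, q_i)] vanish, so every box [(i, j)] with [j <= q_i] belongs
    to the diagram; a further box would lie beyond all essential ones. *)
Lemma flag_staircase_diagram (w : 'S_n) d (p q : 'I_d -> nat) :
  flagging_set w p q -> (forall i, p i = i.+1) ->
  forall i j : 'I_n, ((i, j) \in diagram w)
    = if insub (i : nat) is Some o then (j < q o)%N else false.
Proof.
move=> fl hp i j; case: insubP => [o _ oi|io]; last first.
  apply/negP => /(flag_box fl)[m [hm _ _ _ _]]; rewrite hp in hm.
  by move: io; have := ltn_ord m; lia.
have h0 (m : 'I_d) (a b : 'I_n) : (a <= m)%N -> (b < q m)%N -> (a, b) \in diagram w.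
  move=> am bq; have [_ hq] := flag_le fl m; have := flag_rank fl m; rewrite hp => hr.
  have z a0 : (a0 <= m)%N -> rank_fun w a0.+1 (q m) = 0%N.
    by move=> le; have := @rank_lipl _ w a0.+1 m.+1 (q m); have [+ _] := flag_le fl m;
      rewrite hp; lia.
  have wq (a0 : 'I_n) : (a0 <= m)%N -> (q m <= w a0)%N.
    by move=> le; have := z a0 le; rewrite rank_Sl; case: (ltnP (w a0) (q m)) => // _; rewrite addn1.
  rewrite diagramE (leq_trans bq) ?wq //= ltnNge; apply/negP => le.
  by have := wq _ (leq_trans le am); rewrite permKV; lia.
apply/idP/idP => [hD|]; last by apply: h0; rewrite oi.
have [m [hm hq _ _ _]] := flag_box fl hD; rewrite hp in hm.
have om : (o <= m)%N by rewrite oi; lia.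
by have [_ h] := flag_mono fl om; lia.
Qed.

Lemma flag_groth_dominant (w : 'S_n) d (p q : 'I_d -> nat) :
  flagging_set w p q -> (forall i, p i = i.+1) ->
  toA (double_grothendieck w) = \det (flag_mx n p q).
Proof.
move=> fl hp; have hD := flag_staircase_diagram fl hp.
have -> : p = (fun i => i.+1) by apply/funext.
have hq i : (q i <= n)%N by have [] := flag_le fl i.
have hd : (d <= n)%N.
  case: (posnP d) => [->//|d0]; have hd1 : (d.-1 < d)%N by lia.
  by have [+ _] := flag_le fl (Ordinal hd1); rewrite hp /=; lia.
rewrite flag_det_dominant // groth_dominant; last first.
  move=> i j i' j'; rewrite !hD; case: insubP => // o _ /= oi jq hi hj.
  case: insubP => [o' _ /= oi'|]; last by have := ltn_ord o; lia.
  have oo : (o' <= o)%N by rewrite oi' oi.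
  by have [_ h] := flag_mono fl oo; lia.
rewrite rmorph_prod /=.
pose F (i : nat) : A := if insub i is Some o then
  \prod_(j < n | (j < q o)%N) (xnat n i + bb j + be * xnat n i * bb j) else 1.
rewrite [RHS](eq_bigr (fun i : 'I_d => F i)); last by move=> i _; rewrite /F valK.
rewrite (big_ord_widen n F hd).
rewrite [RHS](eq_bigr (fun i : 'I_n => \prod_(j < n | (i, j) \in diagram w)
    (xnat n i + bb j + be * xnat n i * bb j))); last first.
  move=> i id; rewrite /F; case: insubP => [o _ oi|]; last by rewrite id.
  by apply: eq_bigl => j; rewrite hD -oi valK.
rewrite pair_big_dep; apply: eq_big => [[i j]|[i j] _] /=.
  by apply/esym/andb_idl; rewrite hD; case: insubP.
by rewrite xnatE !rmorphD !rmorphM.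
Qed.

(** Induction on the sum of the [p_i]: the divided difference that leads from
    [w s_a] to [w] is the one that moves [p_k] from [a] to [a + 1]. *)
Lemma flag_groth (w : 'S_n) d (p q : 'I_d -> nat) :
  flagging_set w p q -> toA (double_grothendieck w) = \det (flag_mx n p q).
Proof.
have [m] := ubnP (\sum_i p i)%N; elim: m w p => // m IH w p hm fl.
have [/existsP ex|/existsPn nex] := boolP [exists k, p k != k.+1]; last first.
  by apply: flag_groth_dominant fl _ => i; apply/eqP; rewrite -[_ == _]negbK nex.
have [k pk kmin] : exists2 k : 'I_d, p k <> k.+1 & forall i : 'I_d, (i < k)%N -> p i = i.+1.
  have [k0 hk0] := ex; 
  case: (@arg_minnP _ k0 (fun i => p i != i.+1) (fun i : 'I_d => i : nat) hk0)
    => k /eqP pk kmin.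
  exists k => // i ik; apply/eqP; apply: contraTT ik => /kmin.
  by rewrite -leqNgt.
have [a [a' [aa' wa pa hoth fl']]] := flag_step fl kmin pk.
have upk : flag_up p k k = a.+1 by rewrite /flag_up eqxx pa.
have upo i : i != k -> flag_up p k i = p i by rewrite /flag_up => /negPf->.
have hv := IH (mul_s w a a') (flag_up p k) _ fl'.
have [hp hq] : (forall i, flag_up p k i <= n)%N /\ (forall i, q i <= n)%N.
  by split=> i; have [] := flag_le fl' i.
apply/eqP; rewrite -subr_eq0; apply/eqP.
have na : lshift n a != lshift n a' by rewrite -val_eqE /= aa'; lia.
apply: (reg_subX na); rewrite mulrBr; apply/eqP; rewrite subr_eq0; apply/eqP.
have det := flag_det_pi aa' hp hq upk pa.
have e : toA (xvar a - xvar a') = xx a - xx a' by rewrite rmorphB.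
transitivity ((xx a - xx a') * \det (flag_mx n p q)); last by rewrite -e.
rewrite -[LHS]rmorphM (groth_pi aa' wa) det => [|i ik]; last by rewrite upo //; split => //; apply: hoth.
rewrite -hv ?ser_sym_mpoly; last first.
  rewrite ltnS in hm; apply: leq_trans hm; rewrite [X in (_ < X)%N](bigD1 k) //=.
  rewrite (bigD1 k) //= upk pa (addSn a.+1) ltnS leq_add2l.
  by apply: leq_sum => i ik; rewrite upo.
by rewrite rmorphB !rmorphM !rmorphD rmorph1 !rmorphM.
Qed.

End FlagFormula.

Theorem theorem5p1 (n : nat) (w : 'S_n) (lam : seq nat)
    (d : nat) (p q : 'I_d -> nat) :
  vexillary w -> shape_of w lam -> flagging_set w p q ->
  mfps_of_mpoly (double_grothendieck w)
    = \det (\matrix_(i < d, j < d)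
        mfps_sum (fun s : nat =>
          (gbinom (i.+1%:Z - d%:Z) s)%:~R * mfps_of_mpoly beta ^+ s
          * Gseries n (p i) (q i)
              ((nth 0%N lam i)%:Z + j%:Z - i%:Z + s%:Z)))
  /\
  mfps_of_mpoly (double_grothendieck w)
    = \det (\matrix_(i < d, j < d)
        mfps_sum (fun s : nat =>
          (gbinom (i%:Z - j%:Z) s)%:~R * mfps_of_mpoly beta ^+ s
          * Gseries n (p i) (q i)
              ((nth 0%N lam i)%:Z + j%:Z - i%:Z + s%:Z))).
Proof.
move=> vex shp fl.
have idx (i j : 'I_d) : (nth 0%N lam i)%:Z + j%:Z - i%:Z = (q i)%:Z - (p i)%:Z + 1 + j%:Z.
  by have := shape_flag i vex shp fl; have := flag_rank fl i; lia.
have main := flag_groth fl; split; rewrite {}main.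
  congr (\det _); apply/matrixP => i j; rewrite !mxE idx; reflexivity.
have hle := flag_le fl.
pose F (i : 'I_d) (t : nat) k := Gpow n (i.+1%:Z - d%:Z + t%:Z) (p i) (q i) k.
pose mu (i : 'I_d) : int := (q i)%:Z - (p i)%:Z + 1.
have hF i t k : F i t.+1 k = F i t k + mfps_of_mpoly beta * F i t (k + 1).
  have [hp hq] := hle i; rewrite /F -Gpow_T // (_ : _ + t.+1%:Z = i.+1%:Z - d%:Z + t%:Z + 1) //.
  by lia.
transitivity (\det (\matrix_(i < d, j < d) F i 0%N (mu i + j%:Z))).
  by congr (\det _); apply/matrixP => i j; rewrite !mxE /F addr0.
rewrite (det_pascal _ hF); congr (\det _); apply/matrixP => i j; rewrite !mxE idx /F.
have -> // : i.+1%:Z - d%:Z + (d.-1 - j)%N%:Z = i%:Z - j%:Z.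
by have := ltn_ord j; lia.
Qed.
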